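(* Let $k\geq 1$ and let $n_1,n_2,\ldots,n_k$ be composite positive integers. Suppose that $\Gamma$ is a group isomorphic to $\bigoplus_{i=1}^k\mathbb{Z}_{n_i}$. Then there exists a spherical latin bitrade whose canonical group is isomorphic to $\Gamma$.
   Context: Partial latin square: given finite, pairwise disjoint sets $R$ (rows), $C$ (columns), $S$ (symbols), a partial latin square is a subset $P\subseteq R\times C\times S$ such that any two distinct triples of $P$ agree in at most one coordinate; it is assumed that every element of $R$, $C$ and $S$ occurs in some triple of $P$. Latin bitrade: an ordered pair $(W,B)$ of non-empty partial latin squares (with common sets $R,C,S$) such that for each triple $(r,c,s)\in W$ (respectively $B$) there exist unique $r'\neq r$, $c'\neq c$, $s'\neq s$ with $\{(r',c,s),(r,c',s),(r,c,s')\}\subset B$ (respectively $W$). Its size is $|W|=|B|$. It is connected if there is no latin bitrade $(W',B')$ with $W'\subsetneq W$ and $B'\subsetneq B$. Separated: for each row $r$, define a permutation $\rho_r$ of the symbols in row $r$ by $\rho_r(s)=s'$ if and only if $(r,c,s)\in W$ and $(r,c,s')\in B$ for some $c\in C$; the row $r$ is separated if $\rho_r$ is a single cycle. Separated columns and symbols are defined analogously. The bitrade is separated if every row, column and symbol is separated. Spherical: from a connected separated latin bitrade $(W,B)$ construct a face two-coloured triangulation of a closed orientable surface with vertex set $R\sqcup C\sqcup S$, with an edge between two vertices if and only if they occur together in a triple of $W$ (equivalently of $B$), a white triangular face with vertices $r,c,s$ for each $(r,c,s)\in W$, and a black triangular face with vertices $r,c,s$ for each $(r,c,s)\in B$. A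 spherical latin bitrade is a connected separated latin bitrade for which this surface is the sphere (equivalently, a connected latin bitrade with $|R|+|C|+|S|=|W|+2$). Canonical group: for a partial latin square $P$ with sets $R,C,S$, let $\mathcal{A}_P$ be the abelian group with generating set $R\cup C\cup S$ subject to the relations $r+c+s=0$ for all $(r,c,s)\in P$. It is known that for a spherical latin bitrade $(W,B)$ one has $\mathcal{A}_W\cong\mathcal{A}_B\cong\mathbb{Z}\oplus\mathbb{Z}\oplus\mathcal{C}$ with $\mathcal{C}$ finite. The group $\mathcal{C}$ (the torsion subgroup of $\mathcal{A}_W$) is called the canonical group of $(W,B)$. $\mathbb{Z}_n$ denotes the cyclic group of order $n$. *)

(* Defs.v *)
From HB Require Import structures.
From mathcomp Require Import all_boot all_order all_algebra all_fingroup.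
From mathcomp Require Import boolp zify.

Set Implicit Arguments.
Unset Strict Implicit.
Unset Printing Implicit Defensive.

Import Order.TTheory GRing.Theory Num.Theory.

Section Bitrade.

Variables R C S : finType.

Notation triple := (R * C * S)%type.
Implicit Types (P Q W B : {set triple}).

(* The row, column and symbol sets are subsets of ambient finite types, so that
   the sub-bitrades in [connected] may use fewer rows, columns and symbols. *)
Definition partial_latin_square
    (Rs : {set R}) (Cs : {set C}) (Ss : {set S}) P : Prop :=
  [/\ forall r c s, (r, c, s) \in P -> [/\ r \in Rs, c \in Cs & s \in Ss],
      forall t u, t \in P -> u \in P -> t != u ->
        (t.1.1 == u.1.1) + (t.1.2 == u.1.2) + (t.2 == u.2) <= 1,
      forall r, r \in Rs -> exists c s, (r, c, s) \in P,
      forall c, c \in Cs -> exists r s, (r, c, s) \in P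
    & forall s, s \in Ss -> exists r c, (r, c, s) \in P].

Definition mates_in P Q : Prop :=
  forall r c s, (r, c, s) \in P ->
    [/\ exists! r', r' != r /\ (r', c, s) \in Q,
        exists! c', c' != c /\ (r, c', s) \in Q
      & exists! s', s' != s /\ (r, c, s') \in Q].

Definition latin_bitrade
    (Rs : {set R}) (Cs : {set C}) (Ss : {set S}) W B : Prop :=
  [/\ W != set0 /\ B != set0,
      partial_latin_square Rs Cs Ss W,
      partial_latin_square Rs Cs Ss B,
      mates_in W B
    & mates_in B W].

Definition connected W B : Prop :=
  ~ exists Rs Cs Ss W' B',
      [/\ latin_bitrade Rs Cs Ss W' B', W' \proper W & B' \proper B].

(* [e] is the graph of a permutation of [D]; that permutation is a single cycle
   when [D] can be listed without repetition as a cycle of [e]. *)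
Definition single_cycle (T : finType) (D : {set T}) (e : rel T) : Prop :=
  exists2 l : seq T, l =i D & ucycle e l.

Definition row_perm W B r : rel S :=
  fun s s' => [exists c, ((r, c, s) \in W) && ((r, c, s') \in B)].
Definition column_perm W B c : rel R :=
  fun r r' => [exists s, ((r, c, s) \in W) && ((r', c, s) \in B)].
Definition symbol_perm W B s : rel C :=
  fun c c' => [exists r, ((r, c, s) \in W) && ((r, c', s) \in B)].

Definition separated W B : Prop :=
  [/\ forall r, single_cycle [set s | [exists c, (r, c, s) \in W]]
                             (row_perm W B r),
      forall c, single_cycle [set r | [exists s, (r, c, s) \in W]]
                             (column_perm W B c)
    & forall s, single_cycle [set c | [exists r, (r, c, s) \in W]]
                             (symbol_perm W B s)].

Notation vertex := (R + C + S)%type.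

Definition rvertex (r : R) : vertex := inl (inl r).
Definition cvertex (c : C) : vertex := inl (inr c).
Definition svertex (s : S) : vertex := inr s.

Definition face (t : triple) : {set vertex} :=
  [set rvertex t.1.1; cvertex t.1.2; svertex t.2].

Definition edges W : {set {set vertex}} :=
  [set e : {set vertex} | (#|e| == 2) && [exists t in W, e \subset face t]].

(* V - E + F: the white faces are the elements of W, the black ones those of
   B. *)
Definition euler_char W B : int :=
  (#|{: vertex}|%:Z - #|edges W|%:Z + (#|W| + #|B|)%:Z)%R.

(* The surface of a connected separated bitrade is closed, connected and
   orientable, so it is the sphere exactly when its Euler characteristic is 2;
   by [euler_char_bitrade] below this says #|R| + #|C| + #|S| = #|W| + 2. *)
Definition spherical_bitrade W B : Prop :=
  [/\ latin_bitrade [set: R] [set: C] [set: S] W B,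
      connected W B,
      separated W B
    & euler_char W B = 2%R].

End Bitrade.

Section EulerCharacteristic.

Variables R C S : finType.
Implicit Types (W B : {set R * C * S}).

Let rv := rvertex (R := R) C S.
Let cv := cvertex (C := C) R S.
Let sv := svertex (S := S) R C.

Lemma pls_inj Rs Cs Ss W t u :
  partial_latin_square Rs Cs Ss W -> t \in W -> u \in W ->
  1 < (t.1.1 == u.1.1) + (t.1.2 == u.1.2) + (t.2 == u.2) -> t = u.
Proof.
case=> _ agree _ _ _ tW uW; apply: contraTeq => /(agree _ _ tW uW).
by rewrite -leqNgt.
Qed.

Lemma leq_card_mates Rs Cs Ss W B :
  partial_latin_square Rs Cs Ss W -> mates_in W B -> #|W| <= #|B|.
Proof.
move=> plsW mates.
pose f (t : R * C * S) :=
  (t.1, odflt t.2 [pick s | (s != t.2) && ((t.1, s) \in B)]).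
have fB t : t \in W -> f t \in B.
  case: t => [[r c] s] /mates[_ _ [s' [[ns' s'B] _]]]; rewrite /f /=.
  by case: pickP => [s1 /andP[]//|/(_ s')]; rewrite ns' s'B.
rewrite -(card_in_imset (f := f) (D := W)).
  by apply/subset_leq_card/subsetP => _ /imsetP[t /fB fBt ->].
move=> [[r c] s] [[r' c'] s'] tW uW [rr cc _].
by apply: (pls_inj plsW tW uW); rewrite rr cc !eqxx.
Qed.

Lemma card_edges Rs Cs Ss W :
  partial_latin_square Rs Cs Ss W -> #|edges W| = 3 * #|W|.
Proof.
move=> plsW.
pose rc (t : R * C * S) := [set rv t.1.1; cv t.1.2].
pose rs (t : R * C * S) := [set rv t.1.1; sv t.2].
pose cs (t : R * C * S) := [set cv t.1.2; sv t.2].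
have rcI : {in W &, injective rc}.
  move=> t u tW uW /setP e; apply: (pls_inj plsW tW uW).
  move: (e (rv t.1.1)) (e (cv t.1.2)); rewrite !in_set2 !eqxx orbT /= orbF.
  by move=> /esym/eqP[->] /esym/eqP[->]; rewrite !eqxx.
have rsI : {in W &, injective rs}.
  move=> t u tW uW /setP e; apply: (pls_inj plsW tW uW).
  move: (e (rv t.1.1)) (e (sv t.2)); rewrite !in_set2 !eqxx orbT /= orbF.
  by move=> /esym/eqP[->] /esym/eqP[->]; rewrite !eqxx addn1.
have csI : {in W &, injective cs}.
  move=> t u tW uW /setP e; apply: (pls_inj plsW tW uW).
  move: (e (cv t.1.2)) (e (sv t.2)); rewrite !in_set2 !eqxx orbT /= orbF.
  by move=> /esym/eqP[->] /esym/eqP[->]; rewrite !eqxx addn1 addnS.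
have -> : edges W = rc @: W :|: (rs @: W :|: cs @: W).
  apply/setP => e; rewrite !inE; apply/idP/idP.
    case/andP => /cards2P[a [b [nab ->]]] /existsP[t /andP[tW]].
    have rcW : [set rvertex C S t.1.1; cvertex R S t.1.2] \in rc @: W
      by exact: (imset_f rc tW).
    have rsW : [set rvertex C S t.1.1; svertex R C t.2] \in rs @: W
      by exact: (imset_f rs tW).
    have csW : [set cvertex R S t.1.2; svertex R C t.2] \in cs @: W
      by exact: (imset_f cs tW).
    move=> /subsetP sub.
    have := sub a (set21 _ _); have := sub b (set22 _ _).
    rewrite !inE => /orP[/orP[]|] /eqP bE /orP[/orP[]|] /eqP aE;
      move: nab; rewrite bE aE ?eqxx // => _;
      by [rewrite ?rcW ?rsW ?csW ?orbT | rewrite setUC ?rcW ?rsW ?csW ?orbT].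
  case/or3P => /imsetP[t tW ->]; rewrite cards2 /=; apply/existsP; exists t;
    rewrite tW /=; apply/subsetP => v; rewrite !inE.
  - by move->.
  - by case/orP => ->; rewrite ?orbT.
  - by case/orP => ->; rewrite ?orbT.
rewrite !cardsU (card_in_imset rcI) (card_in_imset rsI) (card_in_imset csI).
have -> : rs @: W :&: cs @: W = set0.
  apply/setP => e; rewrite !inE; apply/negP.
  case/andP => /imsetP[t _ ->] /imsetP[u _ /setP/(_ (rv t.1.1))].
  by rewrite !inE eqxx.
have -> : rc @: W :&: (rs @: W :|: cs @: W) = set0.
  apply/setP => e; rewrite !inE; apply/negP.
  case/andP => /imsetP[t _ ->] /orP[] /imsetP[u _ /setP/(_ (sv u.2))];
    by rewrite !inE eqxx orbT.
by rewrite cards0 !subn0 !mulSn mul0n addn0.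
Qed.

Lemma euler_char_bitrade Rs Cs Ss W B : latin_bitrade Rs Cs Ss W B ->
  euler_char W B = 2%R <-> #|R| + #|C| + #|S| = #|W| + 2.
Proof.
case=> _ plsW plsB WB BW; rewrite /euler_char (card_edges plsW) !card_sum.
have -> : #|B| = #|W|.
  apply/eqP; rewrite eqn_leq (leq_card_mates plsB BW).
  exact: leq_card_mates plsW WB.
by split; lia.
Qed.

End EulerCharacteristic.

Section IntegerSpan.

Variables (V : zmodType) (I : finType) (D : {set I}) (F : I -> V).

Local Open Scope ring_scope.

Definition int_span : {pred V} :=
  fun x => `[< exists a : I -> int, x = \sum_(i in D) F i *~ a i >].

Lemma int_span_zmod_closed : zmod_closed int_span.
Proof.
split=> [|x y /asboolP[a ->] /asboolP[b ->]]; apply/asboolP.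
  by exists (fun=> 0); rewrite big1.
exists (fun i => a i - b i); rewrite -sumrB.
by apply: eq_bigr => i _; rewrite mulrzBr.
Qed.

HB.instance Definition _ := GRing.isZmodClosed.Build V int_span
  int_span_zmod_closed.

End IntegerSpan.

Section Torsion.

Variable A : zmodType.

Local Open Scope ring_scope.

Definition torsion : {pred A} :=
  fun x => `[< exists2 n, (0 < n)%N & x *+ n = 0 >].

Lemma torsion_zmod_closed : zmod_closed torsion.
Proof.
split=> [|x y /asboolP[m m0 xm] /asboolP[n n0 yn]]; apply/asboolP.
  by exists 1%N.
exists (m * n)%N; first by rewrite muln_gt0 m0.
by rewrite mulrnBl mulrnA xm mul0rn mulnC mulrnA yn mul0rn subr0.
Qed.

HB.instance Definition _ := GRing.isZmodClosed.Build A torsion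
  torsion_zmod_closed.

Record torsion_subgroup : predArgType :=
  TorsionElement { torsion_val : A; _ : torsion_val \in torsion }.

HB.instance Definition _ := [isSub for torsion_val].
HB.instance Definition _ := [Choice of torsion_subgroup by <:].
HB.instance Definition _ :=
  [SubChoice_isSubZmodule of torsion_subgroup by <:].

End Torsion.

Section CanonicalGroup.

Variables R C S : finType.

Local Open Scope ring_scope.

Notation free_group := {ffun (R + C + S)%type -> int}.

Definition generator (v : R + C + S) : free_group := [ffun u => (u == v)%:R].

Definition relator (t : R * C * S) : free_group :=
  generator (rvertex C S t.1.1) + generator (cvertex R S t.1.2)
  + generator (svertex R C t.2).

Definition presented_group (P : {set R * C * S}) : zmodType :=
  Quotient.quot (int_span P relator).

Definition canonical_group (W : {set R * C * S}) : zmodType :=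
  torsion_subgroup (presented_group W).

End CanonicalGroup.

Definition isomorphic (G H : groupType) : Prop :=
  exists2 f : G -> H, bijective f & {morph f : x y / (x * y)%g}.

Definition composite (n : nat) : bool := (1 < n) && ~~ prime n.

(* Main.v *)
From HB Require Import structures.
Require Import Defs.
From mathcomp Require Import all_boot all_order all_algebra all_fingroup.
From mathcomp Require Import boolp zify.

(* Cyclic 2 x q trades (rows 0 and j, and q columns and symbols, triples (0,i,i)
   and (j,i,i+1) against (j,i,i) and (0,i,i+1)) are spherical with canonical
   group Z_q.  They are glued into a chain along triangles, the colours of
   consecutive trades being opposite: a triangle of one colour is removed
   together with the one of the other colour it is identified with.

   If tau = r + c + s is the value at the black triangle (r, c, s) of the next
   gluing, then gluing a 2 x b trade and, to a second white triangle of it, a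
   2 x p trade adjoins to the canonical group two elements x, y with
   b y = tau + x and p x = 0, that is, an element y with (b p) y = p tau.  So
   the summand Z_(b p) splits off as soon as p tau is divisible by b p, and the
   new end value -x is again killed by p.  A composite n can always be written
   as b p with p prime so that this happens when tau is killed by a prime q:
   take p = q if q divides n, and any p otherwise since n is then invertible on
   the q-torsion. *)

Set Implicit Arguments.
Unset Strict Implicit.
Unset Printing Implicit Defensive.

Import Order.TTheory GRing.Theory Num.Theory.

(** * Chains of trades *)

(* Rows, columns and symbols play the same role: [turn k t] for [k] = 0, 1, 2
   lists the fixed coordinate, the linking one and the permuted one in the
   definition of the permutation of a row, a column or a symbol. *)
Definition turn (T : Type) (k : nat) (t : T * T * T) : T * T * T :=
  match k with
  | 0 => t
  | 1 => (t.1.2, t.2, t.1.1)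
  | _ => (t.2, t.1.1, t.1.2)
  end.

(** One step around the vertex [x] of the triangulation: from the edge [x y] across a face of [P],
    then across the face of [Q] adjacent to it, to the edge [x y']. *)
Definition link (T : eqType) (P Q : seq (T * T * T)) (x : T) : rel T :=
  fun y y' =>
    has (fun w => [&& w.1.1 == x, w.2 == y & (w.1, y') \in Q]) P.

Definition fibre (T : eqType) (P : seq (T * T * T)) (x : T) : seq T :=
  [seq w.2 | w <- P & w.1.1 == x].

Definition separated_at (T : eqType) (P Q : seq (T * T * T)) (x : T) : Prop :=
  exists2 l, l =i fibre P x & ucycle (link P Q x) l.

Section Separated.

Variable T : eqType.
Implicit Types (P Q : seq (T * T * T)) (x y : T).

Lemma linkP P Q x y y' :
  reflect (exists2 z, (x, z, y) \in P & (x, z, y') \in Q) (link P Q x y y').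
Proof.
apply: (iffP hasP) => [[[[a z] b] aP /and3P[/eqP/= <- /eqP <- zQ]] | [z zP zQ]].
  by exists z.
by exists (x, z, y); rewrite //= !eqxx.
Qed.

Lemma mem_fibre P x y :
  reflect (exists z, (x, z, y) \in P) (y \in fibre P x).
Proof.
apply: (iffP mapP) => [[[[a z] b]]|[z zP]].
  by rewrite mem_filter => /andP[/eqP/= <- bP] ->; exists z.
by exists (x, z, y); rewrite // mem_filter eqxx.
Qed.

(** Exchanging the colours inverts the permutation at [x], so the reversed list is a cycle. *)
Lemma separated_at_sym P Q x :
  fibre P x =i fibre Q x -> separated_at P Q x -> separated_at Q P x.
Proof.
move=> PQ [l lP /andP[cl ul]]; exists (rev l) => [y|].
  by rewrite mem_rev lP PQ.
rewrite /ucycle rev_uniq ul andbT rev_cycle.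
apply: sub_cycle cl => y y' /linkP[z zP zQ]; apply/linkP; by exists z.
Qed.

Lemma sub_separated_at P Q P' Q' x :
  {in P, forall w, w.1.1 = x -> w \in P'} ->
  {in Q, forall w, w.1.1 = x -> w \in Q'} ->
  {in P', forall w, w.1.1 = x -> w \in P} ->
  separated_at P Q x -> separated_at P' Q' x.
Proof.
move=> PP' QQ' P'P [l lP /andP[cl ul]]; exists l.
  move=> y; rewrite lP; apply/mem_fibre/mem_fibre => -[z zP]; exists z.
    exact: PP' zP erefl.
  exact: P'P zP erefl.
rewrite /ucycle ul andbT; apply: sub_cycle cl => y y' /linkP[z zP zQ].
by apply/linkP; exists z; [apply: PP' zP _ | apply: QQ' zQ _].
Qed.

(* The cycle of [P, Q] at [x] gets [s] inserted in front of [y0]. *)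
Lemma separated_at_insert P Q P' Q' x y0 s :
  y0 \in fibre P x -> uniq s -> {in s, forall y, y \notin fibre P x} ->
  (forall y, (y \in fibre P' x) = (y \in fibre P x) || (y \in s)) ->
  (forall y y', y' != y0 -> link P Q x y y' -> link P' Q' x y y') ->
  (forall y, link P Q x y y0 -> path (link P' Q' x) y (rcons s y0)) ->
  separated_at P Q x -> separated_at P' Q' x.
Proof.
move=> y0P us sP P'E keep ins [l lP /andP[cl ul]].
(* Rotated to start at [y0], the cycle ends with the predecessor of [y0], so that [s] is simply
   appended. *)
have [i l1 El] : rot_to_spec l y0 by apply: rot_to; rewrite lP.
have l1P y : (y \in fibre P x) = (y == y0) || (y \in l1).
  by rewrite -lP -(mem_rot i) El inE.
have : uniq (y0 :: l1) by rewrite -El rot_uniq.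
rewrite cons_uniq => /andP[y0l1 ul1].
have : path.cycle (link P Q x) (y0 :: l1) by rewrite -El rot_cycle.
rewrite /= rcons_path => /andP[pl1 /ins]; rewrite rcons_path => /andP[ps lst].
have keep_path z q : y0 \notin q -> path (link P Q x) z q ->
    path (link P' Q' x) z q.
  elim: q z => //= a q IHq z; rewrite inE negb_or => /andP[y0a y0q].
  by case/andP=> za /(IHq _ y0q) ->; rewrite keep // eq_sym.
exists (y0 :: l1 ++ s).
  by move=> y; rewrite P'E inE mem_cat l1P -orbA.
rewrite /ucycle cons_uniq /= mem_cat negb_or y0l1 cat_uniq ul1 us.
rewrite rcons_path cat_path last_cat ps lst keep_path // !andbT /=.
apply/andP; split; last by apply/hasPn => y /sP; rewrite l1P => /norP[].
by apply/negP => /sP; rewrite y0P.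
Qed.

End Separated.

(** Cyclic successor on the interval from [N] to [M], replacing addition of 1 modulo q in the cyclic
    trade. *)
Definition nxt (N M i : nat) : nat := if i == M then N else i.+1.

Lemma nxtP N M i : (i = M /\ nxt N M i = N) \/ (i <> M /\ nxt N M i = i.+1).
Proof. by rewrite /nxt; case: eqP => ?; [left | right]. Qed.

Local Notation triple := (nat * nat * nat)%type.

Definition diag (a : nat) (I : seq nat) : seq triple :=
  [seq (a, i, i) | i <- I].
Definition offdiag (a N M : nat) (I : seq nat) : seq triple :=
  [seq (a, i, nxt N M i) | i <- I].

(* Glues, along the black triangle [(0, N, N)], the trade on rows [0] and [m]
   and on the columns and symbols from [N] to [N + n]. *)
Definition grow_white (m N n : nat) (W : seq triple) : seq triple :=
  W ++ diag 0 (iota N.+1 n) ++ offdiag m N (N + n) (iota N n.+1).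
Definition grow_black (m N n : nat) (B : seq triple) : seq triple :=
  rem (0, N, N) B ++ diag m (iota N n.+1) ++ offdiag 0 N (N + n) (iota N n.+1).

(** An edge of the triangle [t]: row-column, column-symbol or symbol-row. Faces of opposite colours
    with a common shadow are adjacent. *)
Definition shadow (k : nat) (t : triple) : nat * nat := (turn k t).1.

(* At [N = 0] the chain is degenerate, a single triangle of both colours, whence
   the exception to disjointness. *)
Record chain (m N : nat) (W B : seq triple) : Prop := Chain {
  chain_rows : forall r, (r \in [seq t.1.1 | t <- W]) = (r < m);
  chain_columns : forall c, (c \in [seq t.1.2 | t <- W]) = (c <= N);
  chain_symbols : forall s, (s \in [seq t.2 | t <- W]) = (s <= N);
  chain_shadow_uniq : forall k, uniq (map (shadow k) W);
  chain_shadow_eq : forall k, perm_eq (map (shadow k) W) (map (shadow k) B);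
  chain_end : (0, N, N) \in B;
  chain_disjoint : forall t, t \in W -> t \in B -> t = (0, N, N) /\ N = 0;
  chain_size : size W = m + N.*2;
  chain_connected : forall X Y : triple -> Prop,
    (forall k w b, w \in W -> b \in B -> shadow k w = shadow k b ->
                   X w <-> Y b) ->
    exists p : Prop, {in W, forall w, X w <-> p} /\ {in B, forall b, Y b <-> p};
  chain_separated : forall k x,
    separated_at (map (turn k) W) (map (turn k) B) x
}.

Lemma uniq_map_inj_in (T1 T2 : eqType) (f : T1 -> T2) s :
  uniq (map f s) -> {in s &, injective f}.
Proof.
elim: s => //= a s IHs /andP[fa us] x y; rewrite !inE.
case/predU1P => [->|xs] /predU1P[->|ys] // fxy; last exact: IHs.
  by rewrite fxy map_f in fa.
by rewrite -fxy map_f in fa.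
Qed.

Lemma mem_diag a I r c s :
  ((r, c, s) \in diag a I) = [&& r == a, s == c & c \in I].
Proof.
apply/mapP/and3P => [[i iI [-> -> ->]]|[/eqP-> /eqP-> cI]]; last by exists c.
by rewrite !eqxx.
Qed.

Lemma mem_offdiag a N M I r c s :
  ((r, c, s) \in offdiag a N M I) = [&& r == a, s == nxt N M c & c \in I].
Proof.
apply/mapP/and3P => [[i iI [-> -> ->]]|[/eqP-> /eqP-> cI]]; last by exists c.
by rewrite !eqxx.
Qed.

Lemma mem_turn0 (W : seq triple) t : (t \in map (turn 0) W) = (t \in W).
Proof. by rewrite map_id. Qed.

Lemma mem_turn1 (W : seq triple) a b c :
  ((a, b, c) \in map (turn 1) W) = ((c, a, b) \in W).
Proof.
apply/mapP/idP => [[[[x y] z] xW [-> -> ->]]|aW] //.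
by exists (c, a, b).
Qed.

Lemma mem_turn2 (W : seq triple) k a b c :
  ((a, b, c) \in map (turn k.+2) W) = ((b, c, a) \in W).
Proof.
apply/mapP/idP => [[[[x y] z] xW [-> -> ->]]|aW] //.
by exists (b, c, a).
Qed.

Lemma map_nxt_iota N n :
  map (nxt N (N + n)) (iota N n.+1) = rcons (iota N.+1 n) N.
Proof.
rewrite -addn1 iotaD map_cat -cats1 /= /nxt eqxx (iotaDl 1 N n).
congr (_ ++ _); apply/eq_in_map => i; rewrite mem_iota => /andP[_ lt_i].
by rewrite ltn_eqF.
Qed.

Lemma mem_rows (W : seq triple) r :
  reflect (exists c s, (r, c, s) \in W) (r \in [seq t.1.1 | t <- W]).
Proof.
apply: (iffP mapP) => [[[[a b] c] tW ->]|[c [s tW]]]; first by exists b, c.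
by exists (r, c, s).
Qed.

Lemma mem_columns (W : seq triple) c :
  reflect (exists r s, (r, c, s) \in W) (c \in [seq t.1.2 | t <- W]).
Proof.
apply: (iffP mapP) => [[[[a b] d] tW ->]|[r [s tW]]]; first by exists a, d.
by exists (r, c, s).
Qed.

Lemma mem_symbols (W : seq triple) s :
  reflect (exists r c, (r, c, s) \in W) (s \in [seq t.2 | t <- W]).
Proof.
apply: (iffP mapP) => [[[[a b] d] tW ->]|[r [c tW]]]; first by exists a, b.
by exists (r, c, s).
Qed.

Lemma path_iota (e : rel nat) a n b :
  (forall i, a <= i < a + n -> e i i.+1) -> e (a + n) b ->
  path e a (rcons (iota a.+1 n) b).
Proof.
elim: n a => [|n IHn] a succ last; first by rewrite /= andbT -(addn0 a).
rewrite /= succ ?leqnn ?addnS ?ltnS ?leq_addr //=; apply: IHn.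
  by move=> i /andP[ai ian]; apply: succ; rewrite (ltnW ai) addnS -addSn.
by rewrite addSn -addnS.
Qed.

(** * Gluing one trade to a chain *)

Section Grow.

Variables (m N n : nat) (W B : seq triple).
Hypothesis WB : chain m N W B.
Hypothesis n_gt0 : 0 < n.

Let t0 : triple := (0, N, N).
Let W1 := grow_white m N n W.
Let B1 := grow_black m N n B.

Lemma chain_uniq_white : uniq W.
Proof. exact: map_uniq (chain_shadow_uniq WB 0). Qed.

Lemma chain_shadow_uniq_black k : uniq (map (shadow k) B).
Proof. by rewrite -(perm_uniq (chain_shadow_eq WB k)) (chain_shadow_uniq WB).
  Qed.

Lemma chain_uniq_black : uniq B.
Proof. exact: map_uniq (chain_shadow_uniq_black 0). Qed.

Lemma chain_white_bound r c s :
  (r, c, s) \in W -> [/\ r < m, c <= N & s <= N].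
Proof.
move=> tW; rewrite -(chain_rows WB) -(chain_columns WB) -(chain_symbols WB).
by split; apply/mapP; exists (r, c, s).
Qed.

Lemma chain_mate_white k w :
  w \in W -> exists2 b, b \in B & shadow k w = shadow k b.
Proof.
move=> wW; have : shadow k w \in map (shadow k) B.
  by rewrite -(perm_mem (chain_shadow_eq WB k)) map_f.
by case/mapP=> b bB e; exists b.
Qed.

Lemma chain_mate_black k b :
  b \in B -> exists2 w, w \in W & shadow k b = shadow k w.
Proof.
move=> bB; have : shadow k b \in map (shadow k) W.
  by rewrite (perm_mem (chain_shadow_eq WB k)) map_f.
by case/mapP=> w wB e; exists w.
Qed.

Lemma chain_black_bound r c s :
  (r, c, s) \in B -> [/\ r < m, c <= N & s <= N].
Proof.
move=> tB; have [[[a b] d] /chain_white_bound[? ? ?] [-> ->]] :=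
  chain_mate_black 0 tB.
have [[[a' b'] d'] /chain_white_bound[? ? ?] [_ ->]] := chain_mate_black 1 tB.
by [].
Qed.

Lemma grow_whiteE r c s : ((r, c, s) \in W1) =
  [|| (r, c, s) \in W, [&& r == 0, s == c & N < c <= N + n]
    | [&& r == m, s == nxt N (N + n) c & N <= c <= N + n]].
Proof.
rewrite !mem_cat mem_diag mem_offdiag !mem_iota.
by rewrite addSn addnS !ltnS.
Qed.

Lemma grow_blackE r c s : ((r, c, s) \in B1) =
  [|| ((r, c, s) != t0) && ((r, c, s) \in B),
      [&& r == m, s == c & N <= c <= N + n]
    | [&& r == 0, s == nxt N (N + n) c & N <= c <= N + n]].
Proof.
rewrite !mem_cat mem_diag mem_offdiag !mem_iota.
rewrite (mem_rem_uniq _ chain_uniq_black) inE.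
by rewrite addnS !ltnS.
Qed.

Lemma chain_m_gt0 : 0 < m.
Proof. by have [] := chain_black_bound (chain_end WB). Qed.

(** The shadow of the removed black triangle [(0, N, N)] completes the white diagonal of the new
    trade. What remains is to compare the two colours of the whole trade, where [nxt] permutes the
    interval. *)
Lemma grow_shadow_eq k : perm_eq (map (shadow k) W1) (map (shadow k) B1).
Proof.
rewrite !map_cat.
have WBk := chain_shadow_eq WB k.
have tBk := perm_map (shadow k) (perm_to_rem (chain_end WB)).
have /permPl-> : perm_eq (map (shadow k) W ++ map (shadow k) (diag 0 (iota
  N.+1 n))
    ++ map (shadow k) (offdiag m N (N + n) (iota N n.+1)))
  (map (shadow k) (rem t0 B) ++ map (shadow k) (diag 0 (iota N n.+1))
    ++ map (shadow k) (offdiag m N (N + n) (iota N n.+1))).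
  rewrite (permPl (perm_cat (perm_trans WBk tBk) (perm_refl _))) /=.
  by rewrite perm_sym perm_catC /= perm_cons perm_catC.
rewrite perm_cat2l -!map_comp.
case: k {WBk tBk} => [|[|k]]; first exact: (permEl (perm_catC _ _)).
  exact: perm_refl.
have nxtE a : perm_eq (map (fun i => (nxt N (N + n) i, a)) (iota N n.+1))
                      (map (fun i => (i, a)) (iota N n.+1)).
  rewrite (map_comp (fun i => (i, a)) (nxt N (N + n))) map_nxt_iota.
  by apply: perm_map; rewrite perm_rcons.
apply: (perm_trans (permEl (perm_catC _ _))).
by apply: perm_cat; [exact: nxtE | rewrite perm_sym; exact: nxtE].
Qed.

Lemma grow_white_uniq : uniq W1.
Proof.
rewrite /W1 /grow_white cat_uniq chain_uniq_white cat_uniq.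
rewrite !map_inj_uniq ?iota_uniq ?andbT ?andTb; try by move=> i j [].
apply/andP; split; apply/hasPn => -[[r c] s].
  rewrite mem_cat mem_diag mem_offdiag !mem_iota => H; apply/negP.
  move=> /chain_white_bound[? ? ?]; lia.
rewrite mem_diag mem_offdiag !mem_iota => H; apply/negP.
have := chain_m_gt0; lia.
Qed.

(** The edges of a new white triangle contain row [m] or an index above [N], hence are not old; for
    the edge [(c, nxt c)] this uses that [nxt] moves [N] since [n] is positive. *)
Lemma grow_shadow_uniq k : uniq (map (shadow k) W1).
Proof.
rewrite map_inj_in_uniq ?grow_white_uniq // => -[[r c] s] [[r' c'] s'].
have m_gt0 := chain_m_gt0.
rewrite !grow_whiteE => /orP[tW|t_new] /orP[uW|u_new] e.
- exact: (uniq_map_inj_in (chain_shadow_uniq WB k) tW uW e).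
- exfalso; have [? ? ?] := chain_white_bound tW.
  case: k e u_new => [|[|k]] [<- <-]; have := nxtP N (N + n) c; lia.
- exfalso; have [? ? ?] := chain_white_bound uW.
  case: k e t_new => [|[|k]] [-> ->]; have := nxtP N (N + n) c;
    have := nxtP N (N + n) c'; lia.
have [-> [-> ->]] : r = r' /\ c = c' /\ s = s'.
  case: k e t_new u_new => [|[|k]] [-> ->]; have := nxtP N (N + n) c;
    have := nxtP N (N + n) c'; lia.
by [].
Qed.

(** The only possible common triangle of the old chain is [(0, N, N)], which is removed from the
    black side; the new trade is disjoint because [nxt] has no fixed point in the interval. *)
Lemma grow_disjoint t : t \in W1 -> t \in B1 -> False.
Proof.
case: t => [[r c] s]; rewrite grow_whiteE grow_blackE => tW tB.
have m_gt0 := chain_m_gt0.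
have oldW := @chain_white_bound r c s; have oldB := @chain_black_bound r c s.
case/orP: tB => [/andP[t_neq tB]|tB].
  case/orP: tW => [tW|]; last by case: (oldB tB) => ? ? ?; lia.
  by have [tt _] := chain_disjoint WB tW tB; rewrite tt eqxx in t_neq.
case/orP: tW => [/oldW[? ? ?]|]; move: tB; have := nxtP N (N + n) c; lia.
Qed.

Lemma grow_size : size W1 = m.+1 + (N + n).*2.
Proof.
rewrite /W1 !size_cat !size_map !size_iota (chain_size WB); lia.
Qed.


Lemma grow_rows r : (r \in [seq t.1.1 | t <- W1]) = (r < m.+1).
Proof.
have m_gt0 := chain_m_gt0.
apply/mem_rows/idP => [[c [s]]|].
  rewrite grow_whiteE => /or3P[/chain_white_bound[? ? ?]||]; lia.
rewrite ltnS leq_eqVlt => /predU1P[->|].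
  by exists N, (nxt N (N + n) N);
    rewrite grow_whiteE leqnn leq_addr !eqxx !orbT.
rewrite -(chain_rows WB) => /mem_rows[c [s tW]].
by exists c, s; rewrite grow_whiteE tW.
Qed.

Lemma grow_columns c : (c \in [seq t.1.2 | t <- W1]) = (c <= N + n).
Proof.
apply/mem_columns/idP => [[r [s]]|].
  rewrite grow_whiteE => /or3P[/chain_white_bound[? ? ?]||]; lia.
move=> cN; case: (leqP c N) => [|Nc].
  rewrite -(chain_columns WB) => /mem_columns[r [s tW]].
  by exists r, s; rewrite grow_whiteE tW.
by exists 0, c; rewrite grow_whiteE Nc cN !eqxx !orbT.
Qed.

Lemma grow_symbols s : (s \in [seq t.2 | t <- W1]) = (s <= N + n).
Proof.
apply/mem_symbols/idP => [[r [c]]|].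
  have := nxtP N (N + n) c.
  rewrite grow_whiteE => ? /or3P[/chain_white_bound[? ? ?]||]; lia.
move=> sN; case: (leqP s N) => [|Ns].
  rewrite -(chain_symbols WB) => /mem_symbols[r [c tW]].
  by exists r, c; rewrite grow_whiteE tW.
by exists 0, s; rewrite grow_whiteE Ns sN !eqxx !orbT.
Qed.

(** Connectedness of the dual graph: predicates on faces preserved across edges are constant. The
    row [m] faces form a ring, each new face of row 0 borders this ring, and the old chain borders
    the new trade along the three edges of the removed triangle. *)
Lemma grow_connected (X Y : triple -> Prop) :
  (forall k w b, w \in W1 -> b \in B1 -> shadow k w = shadow k b ->
                 X w <-> Y b) ->
  exists p : Prop, {in W1, forall w, X w <-> p} /\ {in B1, forall b, Y b <-> p}.
Proof.
move=> XY; pose nx := nxt N (N + n).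
have W1m i : N <= i <= N + n -> (m, i, nx i) \in W1.
  by move=> iN; rewrite grow_whiteE iN !eqxx !orbT.
have W10 i : N < i <= N + n -> (0, i, i) \in W1.
  by move=> iN; rewrite grow_whiteE iN !eqxx !orbT.
have B1m i : N <= i <= N + n -> (m, i, i) \in B1.
  by move=> iN; rewrite grow_blackE iN !eqxx !orbT.
have B10 i : N <= i <= N + n -> (0, i, nx i) \in B1.
  by move=> iN; rewrite grow_blackE iN !eqxx !orbT.
have nxP i := nxtP N (N + n) i.
have nx_bound i : N <= i <= N + n -> N <= nx i <= N + n.
  by rewrite /nx; have := nxP i; lia.
pose p := Y (m, N, N); exists p.
have Ym j : j <= n -> Y (m, N + j, N + j) <-> p.
  elim: j => [|j IHj] jn; first by rewrite addn0.
  have iN : N <= N + j <= N + n by lia.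
  have nxj : nx (N + j) = N + j.+1 by rewrite /nx; have := nxP (N + j); lia.
  rewrite -IHj ?(ltnW jn) // -(XY 0 _ _ (W1m _ iN) (B1m _ iN)) //.
  by rewrite -nxj (XY 2 _ _ (W1m _ iN) (B1m _ (nx_bound _ iN))).
have Ymi i : N <= i <= N + n -> Y (m, i, i) <-> p.
  by case/andP=> Ni iN; rewrite -(subnKC Ni) Ym // leq_subLR.
have Xm i : N <= i <= N + n -> X (m, i, nx i) <-> p.
  by move=> iN; rewrite (XY 0 _ _ (W1m _ iN) (B1m _ iN)) // Ymi.
have X0 i : N < i <= N + n -> X (0, i, i) <-> p.
  move=> iN; have iN' : N <= i <= N + n by lia.
  by rewrite (XY 1 _ _ (W10 _ iN) (B1m _ iN')) // Ymi.
have Y0 i : N <= i <= N + n -> Y (0, i, nx i) <-> p.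
  by move=> iN; rewrite -(XY 1 _ _ (W1m _ iN) (B10 _ iN)) // Xm.
(* The removed triangle receives the value of the new trade. Each of its three edges lies on a new
   black triangle, so the hypothesis on the old chain still holds. *)
pose Y' b := if b == t0 then p else Y b.
have W_W1 w : w \in W -> w \in W1 by rewrite mem_cat => ->.
have B_B1 b : b \in B -> b != t0 -> b \in B1.
  by case: b => [[r c] s] bB bt; rewrite grow_blackE bt bB.
have N0 : N <= N <= N + n by rewrite leqnn leq_addr.
have Nn : N <= N + n <= N + n by rewrite leqnn leq_addr.
have old k w b : w \in W -> b \in B -> shadow k w = shadow k b -> X w <-> Y' b.
  move=> wW bB; rewrite /Y'; case: eqVneq => [->|bt]; last first.
    by apply: XY; [exact: W_W1 | exact: B_B1].
  have wW1 := W_W1 _ wW; case: k => [|[|k]] e.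
  - by rewrite (XY 0 _ _ wW1 (B10 _ N0) e) Y0.
  - by rewrite (XY 1 _ _ wW1 (B1m _ N0) e) Ymi.
  have nxn : nx (N + n) = N by rewrite /nx; have := nxP (N + n); lia.
  have := B10 _ Nn; rewrite nxn => B1n.
  by rewrite (XY 2 _ _ wW1 B1n e) -{2}nxn Y0.
have [q [Xq Yq]] := chain_connected WB old.
have qp : q <-> p by rewrite -(Yq _ (chain_end WB)) /Y' eqxx.
split=> [[[r c] s]|[[r c] s]].
  rewrite grow_whiteE => /or3P[/Xq->//|/and3P[/eqP-> /eqP-> /X0]//|].
  by case/and3P=> /eqP-> /eqP-> /Xm.
rewrite grow_blackE => /or3P[/andP[bt /Yq]|/and3P[/eqP-> /eqP-> /Ymi]//|].
  by rewrite /Y' (negPf bt) => ->.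
by case/and3P=> /eqP-> /eqP-> /Y0.
Qed.

Let W_W1 w : w \in W -> w \in W1.
Proof. by rewrite mem_cat => ->. Qed.

Let B_B1 b : b \in B -> b != t0 -> b \in B1.
Proof. by case: b => [[r c] s] bB bt; rewrite grow_blackE bt bB. Qed.

(** In row 0 the predecessor of [N] was sent to [N] through the removed triangle; it now goes to
    [N + 1], and from there one climbs to [N + n] and returns to [N]. Row [m] is the descending
    cycle on the interval, and other rows are untouched. *)
Lemma grow_separated_row r :
  separated_at (map (turn 0) W1) (map (turn 0) B1) r.
Proof.
have m_gt0 := chain_m_gt0.
have nx i := nxtP N (N + n) i.
rewrite !map_id; have sepW := chain_separated WB 0; rewrite !map_id in sepW.
have [->|r_neq0] := eqVneq r 0.
  apply: (@separated_at_insert _ _ _ _ _ _ N (iota N.+1 n)) (sepW 0).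
  - have [[[a b] c] wW [? ?]] := chain_mate_black 2 (chain_end WB).
    by apply/mem_fibre; exists b; subst.
  - exact: iota_uniq.
  - move=> y; rewrite mem_iota => yN; apply/mem_fibre => -[z].
    by case/chain_white_bound; lia.
  - move=> y; rewrite mem_iota;
      apply/mem_fibre/orP => [[z]|[/mem_fibre[z zW]|yN]].
    + rewrite grow_whiteE => /orP[zW|]; first by left; apply/mem_fibre;
        exists z.
      by right; have := nx z; lia.
    + by exists z; exact: W_W1.
    + by exists y; rewrite grow_whiteE; lia.
  - move=> y y' y'N /linkP[z zW zB]; apply/linkP; exists z; first exact: W_W1.
    by apply: B_B1 zB _; apply: contra y'N => /eqP[_ ->].
  - move=> y /linkP[z zW zB].
    have [zN] : (0, z, N) = t0.
      exact: (uniq_map_inj_in (chain_shadow_uniq_black 2) zB (chain_end WB)).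
    rewrite {z}zN in zW {zB}.
    case: (n) n_gt0 (nx) (grow_whiteE) (grow_blackE) => // n' _ nx' W1E B1E /=.
    apply/andP; split.
      apply/linkP; exists N; first exact: W_W1.
      rewrite B1E; have := nx' N; lia.
    apply: path_iota => [i iN|]; apply/linkP.
      exists i; rewrite ?W1E ?B1E; have := nx' i; lia.
    exists (N.+1 + n'); rewrite ?W1E ?B1E; have := nx' (N.+1 + n'); lia.
have [->|r_neqm] := eqVneq r m.
  exists (rev (iota N n.+1)) => [y|].
    rewrite mem_rev mem_iota; apply/idP/mem_fibre => [yN|[z]].
      have [yN'|yN'] := eqVneq y N.
        exists (N + n); rewrite grow_whiteE; have := nx (N + n); lia.
      exists y.-1; rewrite grow_whiteE; have := nx y.-1; lia.
    rewrite grow_whiteE; have := nx z => ? /or3P[/chain_white_bound[]||]; lia.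
  rewrite /ucycle rev_uniq iota_uniq andbT rev_cycle /=.
  apply: path_iota => [i iN|]; apply/linkP.
    exists i; rewrite ?grow_whiteE ?grow_blackE; have := nx i; lia.
  exists (N + n); rewrite ?grow_whiteE ?grow_blackE; have := nx (N + n); lia.
apply: sub_separated_at (sepW r) => -[[a b] c] aW /= ar.
- exact: W_W1.
- by apply: B_B1 => //; apply/eqP => -[a0 _ _]; rewrite -ar a0 in r_neq0.
- move: aW; rewrite grow_whiteE ar (negPf r_neq0) (negPf r_neqm) /=.
  by rewrite orbF.
Qed.

(** At column [N] the row [m] is inserted in front of row 0; each new column has the 2-cycle on rows
    0 and [m]. *)
Lemma grow_separated_column c :
  separated_at (map (turn 1) W1) (map (turn 1) B1) c.
Proof.
have m_gt0 := chain_m_gt0.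
have nx i := nxtP N (N + n) i.
have sepW := chain_separated WB 1 c.
have [cN|c_neqN] := eqVneq c N.
  rewrite {c}cN in sepW *.
  apply: (@separated_at_insert _ _ _ _ _ _ 0 [:: m]) sepW => //.
  - have [[[a b] d] wW [? ?]] := chain_mate_black 0 (chain_end WB).
    by apply/mem_fibre; exists d; rewrite mem_turn1; subst.
  - move=> y; rewrite inE => /eqP->; apply/mem_fibre => -[z].
    by rewrite mem_turn1 => /chain_white_bound[]; lia.
  - move=> y; rewrite inE; apply/mem_fibre/orP => [[z]|[/mem_fibre[z zW]|ym]].
    + rewrite mem_turn1 grow_whiteE => /orP[zW|].
        by left; apply/mem_fibre; exists z; rewrite mem_turn1.
      by right; have := nx z; lia.
    + by exists z; move: zW; rewrite !mem_turn1; exact: W_W1.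
    + by exists (nxt N (N + n) N); rewrite mem_turn1 grow_whiteE; lia.
  - move=> y y' y'N /linkP[z]; rewrite !mem_turn1 => zW zB.
    apply/linkP; exists z; rewrite mem_turn1; first exact: W_W1.
    by apply: B_B1 zB _; apply: contra y'N => /eqP[->].
  - move=> y /linkP[z]; rewrite !mem_turn1 => zW zB.
    have [zN] : (0, N, z) = t0.
      exact: (uniq_map_inj_in (chain_shadow_uniq_black 0) zB (chain_end WB)).
    rewrite {z}zN in zW {zB} => /=; rewrite andbT.
    apply/andP; split; apply/linkP.
      by exists N; rewrite mem_turn1 ?W_W1 // grow_blackE; lia.
    by exists (nxt N (N + n) N); rewrite mem_turn1 ?grow_whiteE ?grow_blackE;
      lia.
have [cN|c_old] := boolP (N < c <= N + n).
  exists [:: 0; m] => [y|].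
    rewrite !inE; apply/orP/mem_fibre => [[/eqP->|/eqP->]|[z]].
    - by exists c; rewrite mem_turn1 grow_whiteE; lia.
    - by exists (nxt N (N + n) c); rewrite mem_turn1 grow_whiteE; lia.
    rewrite mem_turn1 grow_whiteE => /or3P[/chain_white_bound[]||]; lia.
  rewrite /ucycle /= inE !andbT -andbA; apply/and3P; split; last by lia.
    by apply/linkP; exists c; rewrite mem_turn1 ?grow_whiteE ?grow_blackE; lia.
  apply/linkP; exists (nxt N (N + n) c).
    by rewrite mem_turn1 grow_whiteE; lia.
  by rewrite mem_turn1 grow_blackE; lia.
apply: sub_separated_at sepW => -[[b d] a]; rewrite !mem_turn1 => aW /= bc.
- exact: W_W1.
- by apply: B_B1 => //; apply/eqP => -[_ bN _]; rewrite -bc bN eqxx in c_neqN.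
- by move: aW; rewrite grow_whiteE => /or3P[//||]; lia.
Qed.

(** At symbol [N] the column [N + n] is inserted in front of column [N]; each new symbol [s] has the
    2-cycle on columns [s] and [s - 1]. *)
Lemma grow_separated_symbol k s :
  separated_at (map (turn k.+2) W1) (map (turn k.+2) B1) s.
Proof.
have m_gt0 := chain_m_gt0.
have nx i := nxtP N (N + n) i.
have sepW := chain_separated WB k.+2 s.
have nxn := nx (N + n).
have [sN|s_neqN] := eqVneq s N.
  rewrite {s}sN in sepW *.
  apply: (@separated_at_insert _ _ _ _ _ _ N [:: N + n]) sepW => //.
  - have [[[a b] d] wW [? ?]] := chain_mate_black 1 (chain_end WB).
    by apply/mem_fibre; exists a; rewrite mem_turn2; subst.
  - move=> y; rewrite inE => /eqP->; apply/mem_fibre => -[z].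
    by rewrite mem_turn2 => /chain_white_bound[]; lia.
  - move=> y; rewrite inE; apply/mem_fibre/orP => [[z]|[/mem_fibre[z zW]|ym]].
    + rewrite mem_turn2 grow_whiteE => /orP[zW|].
        by left; apply/mem_fibre; exists z; rewrite mem_turn2.
      by right; have := nx y; lia.
    + by exists z; move: zW; rewrite !mem_turn2; exact: W_W1.
    + by exists m; rewrite mem_turn2 grow_whiteE (eqP ym); lia.
  - move=> y y' y'N /linkP[z]; rewrite !mem_turn2 => zW zB.
    apply/linkP; exists z; rewrite mem_turn2; first exact: W_W1.
    by apply: B_B1 zB _; apply: contra y'N => /eqP[_ ->].
  - move=> y /linkP[z]; rewrite !mem_turn2 => zW zB.
    have [z0] : (z, N, N) = t0.
      exact: (uniq_map_inj_in (chain_shadow_uniq_black 1) zB (chain_end WB)).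
    rewrite {z}z0 in zW {zB} => /=; rewrite andbT.
    apply/andP; split; apply/linkP.
      by exists 0; rewrite mem_turn2 ?W_W1 // grow_blackE; lia.
    by exists m; rewrite mem_turn2 ?grow_whiteE ?grow_blackE; lia.
have [sN|s_old] := boolP (N < s <= N + n).
  have nxs := nx s.-1.
  exists [:: s; s.-1] => [y|].
    rewrite !inE; apply/orP/mem_fibre => [[/eqP->|/eqP->]|[z]].
    - by exists 0; rewrite mem_turn2 grow_whiteE; lia.
    - by exists m; rewrite mem_turn2 grow_whiteE; lia.
    rewrite mem_turn2 grow_whiteE;
      have := nx y => ? /or3P[/chain_white_bound[]||]; lia.
  rewrite /ucycle /= inE !andbT -andbA; apply/and3P; split; last by lia.
    by apply/linkP; exists 0; rewrite mem_turn2 ?grow_whiteE ?grow_blackE; lia.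
  by apply/linkP; exists m; rewrite mem_turn2 ?grow_whiteE ?grow_blackE; lia.
apply: sub_separated_at sepW => -[[d a] b]; rewrite !mem_turn2 => aW /= bc.
- exact: W_W1.
- by apply: B_B1 => //; apply/eqP => -[_ _ bN]; rewrite -bc bN eqxx in s_neqN.
- by move: aW; rewrite grow_whiteE => /or3P[//||]; have := nx b; lia.
Qed.

(** Fibres depend on shadows alone, hence agree for the two colours, as reversing a cycle
    requires. *)
Lemma fibre_turnE P k x y :
  (y \in fibre (map (turn k) P) x) =
  match k with
  | 0 => (y, x) \in map (shadow 2) P
  | 1 => (y, x) \in map (shadow 0) P
  | _ => (y, x) \in map (shadow 1) P
  end.
Proof.
apply/mem_fibre/idP.
  by case: k => [|[|k]] [z]; rewrite ?mem_turn0 ?mem_turn1 ?mem_turn2 => zP;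
    apply/mapP; eexists; try exact: zP.
case: k => [|[|k]] /mapP[[[a b] c] aP [-> ->]];
  rewrite /shadow /=; eexists;
  rewrite ?mem_turn0 ?mem_turn1 ?mem_turn2; exact: aP.
Qed.

(* The colours are exchanged, so that the new end triangle is black again. *)
Lemma grow_chain : chain m.+1 (N + n) B1 W1.
Proof.
have shE k : map (shadow k) B1 =i map (shadow k) W1.
  by move=> x; rewrite (perm_mem (grow_shadow_eq k)).
split.
- move=> r; rewrite -grow_rows.
  have /eq_mem_map e := shE 0; move: (e _ fst r); rewrite -!map_comp; exact.
- move=> c; rewrite -grow_columns.
  have /eq_mem_map e := shE 0; move: (e _ snd c); rewrite -!map_comp; exact.
- move=> s; rewrite -grow_symbols.
  have /eq_mem_map e := shE 1; move: (e _ snd s); rewrite -!map_comp; exact.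
- by move=> k; rewrite -(perm_uniq (grow_shadow_eq k)) grow_shadow_uniq.
- by move=> k; rewrite perm_sym grow_shadow_eq.
- by rewrite grow_whiteE; lia.
- by move=> t tB tW; case: (grow_disjoint tW tB).
- by rewrite -grow_size -(size_map (shadow 0)) -(perm_size (grow_shadow_eq 0))
    size_map.
- move=> X Y XY; have [k w b wW bB e|p [Yp Xp]] := @grow_connected Y X.
    by rewrite (XY k b w).
  by exists p.
move=> k x; apply: separated_at_sym.
  by move=> y; rewrite !fibre_turnE; case: k => [|[|k]]; rewrite shE.
case: k => [|[|k]]; [exact: grow_separated_row | exact: grow_separated_column|].
exact: grow_separated_symbol.
Qed.

End Grow.

Lemma chain_base : chain 1 0 [:: (0, 0, 0)] [:: (0, 0, 0)].
Proof.
split=> //.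
- by case.
- by case.
- by case.
- by move=> t; rewrite !inE => /eqP.
- move=> X Y XY; exists (X (0, 0, 0)); split=> t; rewrite inE => /eqP-> //.
  by rewrite (XY 0 (0, 0, 0) (0, 0, 0)).
have base x : separated_at [:: (0, 0, 0)] [:: (0, 0, 0)] x.
  case: x => [|x]; first by exists [:: 0].
  by exists [::].
by move=> k x; case: k => [|[|k]]; exact: base.
Qed.

(** * The spherical bitrade of a chain *)

Section OrdinalTriples.

Variables m N : nat.

Notation ord_triple := ('I_m * 'I_N.+1 * 'I_N.+1)%type.
Implicit Types (P Q : seq triple).

Definition nat_triple (t : ord_triple) : triple :=
  (nat_of_ord t.1.1, nat_of_ord t.1.2, nat_of_ord t.2).

Definition ord_set P : {set ord_triple} := [set t | nat_triple t \in P].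

Definition bounded P : Prop :=
  forall r c s, (r, c, s) \in P -> [/\ r < m, c <= N & s <= N].

Lemma nat_triple_inj : injective nat_triple.
Proof.
move=> [[r c] s] [[r' c'] s'] [rr cc ss].
by congr (_, _, _); apply: val_inj.
Qed.

Lemma mem_ord_set P r c s :
  ((r, c, s) \in ord_set P) = ((nat_of_ord r, nat_of_ord c, nat_of_ord s) \in
    P).
Proof. by rewrite inE. Qed.

Lemma bounded_ord P r c s : bounded P -> (r, c, s) \in P ->
  exists (r' : 'I_m) (c' s' : 'I_N.+1),
    [/\ r = r', c = c', s = s' & (r', c', s') \in ord_set P].
Proof.
move=> bP tP; have [rm cN sN] := bP _ _ _ tP.
by exists (Ordinal rm), (Ordinal (cN : c < N.+1)), (Ordinal (sN : s < N.+1));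
  rewrite mem_ord_set.
Qed.

Lemma card_ord_set P : bounded P -> uniq P -> #|ord_set P| = size P.
Proof.
move=> bP uP; rewrite cardE -(size_map nat_triple);
  apply/perm_size/uniq_perm=> //.
  by rewrite map_inj_uniq ?enum_uniq //; exact: nat_triple_inj.
move=> [[r c] s]; apply/mapP/idP => [[t]|tP];
  first by rewrite mem_enum inE => ? ->.
have [r' [c' [s' [-> -> -> tS]]]] := bounded_ord bP tP.
by exists (r', c', s'); rewrite ?mem_enum.
Qed.

Lemma partial_latin_square_ord_set P :
  (forall k, uniq (map (shadow k) P)) ->
  (forall r, r < m -> exists c s, (r, c, s) \in P) ->
  (forall c, c <= N -> exists r s, (r, c, s) \in P) ->
  (forall s, s <= N -> exists r c, (r, c, s) \in P) ->
  bounded P ->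
  partial_latin_square [set: 'I_m] [set: 'I_N.+1] [set: 'I_N.+1] (ord_set P).
Proof.
move=> uP rP cP sP bP; split.
- by move=> r c s _; rewrite !inE.
- move=> [[r c] s] [[r' c'] s']; rewrite !mem_ord_set /= => tP uP'.
  apply: contraNT; rewrite -ltnNge => agree; apply/eqP/nat_triple_inj.
  move: agree; case: (eqVneq r r') => [rr|_]; case: (eqVneq c c') => [cc|_];
    case: (eqVneq s s') => [ss|_] //= _; try by rewrite rr cc ss.
  + by subst r' c'; apply: (uniq_map_inj_in (uP 0) tP uP').
  + by subst r' s'; apply: (uniq_map_inj_in (uP 2) tP uP').
  + by subst c' s'; apply: (uniq_map_inj_in (uP 1) tP uP').
- move=> r _; have [c [s tP]] := rP _ (ltn_ord r).
  have [r' [c' [s' [/val_inj-> _ _ tS]]]] := bounded_ord bP tP.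
  by exists c', s'.
- move=> c _; have [r [s tP]] := cP c (ltn_ord c).
  have [r' [c' [s' [_ /val_inj-> _ tS]]]] := bounded_ord bP tP.
  by exists r', s'.
move=> s _; have [r [c tP]] := sP s (ltn_ord s).
have [r' [c' [s' [_ _ /val_inj-> tS]]]] := bounded_ord bP tP.
by exists r', c'.
Qed.

(** The mate across an edge exists by equality of shadows, is unique by injectivity of the shadow on
    [Q], and differs from the given triple by disjointness. *)
Lemma mates_in_ord_set P Q :
  bounded Q -> (forall k, uniq (map (shadow k) Q)) ->
  (forall k t, t \in P -> exists2 u, u \in Q & shadow k t = shadow k u) ->
  (forall t, t \in P -> t \in Q -> False) ->
  mates_in (ord_set P) (ord_set Q).
Proof.
move=> bQ uQ mate PQ r c s; rewrite mem_ord_set => tP; split.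
- have [[[r1 c1] s1] /(bounded_ord bQ)[r' [c' [s' [-> -> -> uQ']]]]] :=
    mate 1 _ tP.
  case=> /val_inj cc /val_inj ss; rewrite -cc -ss in uQ'.
  exists r'; split=> [|r2 [_]].
    split=> //; move: uQ'; rewrite mem_ord_set => uQ'.
    by apply/eqP => rr; rewrite rr in uQ'; exact: PQ uQ'.
  rewrite !mem_ord_set in uQ' * => r2Q.
  by have [/val_inj] := uniq_map_inj_in (uQ 1) uQ' r2Q erefl.
- have [[[r1 c1] s1] /(bounded_ord bQ)[r' [c' [s' [-> -> -> uQ']]]]] :=
    mate 2 _ tP.
  case=> /val_inj ss /val_inj rr; rewrite -rr -ss in uQ'.
  exists c'; split=> [|c2 [_]].
    split=> //; move: uQ'; rewrite mem_ord_set => uQ'.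
    by apply/eqP => cc; rewrite cc in uQ'; exact: PQ uQ'.
  rewrite !mem_ord_set in uQ' * => c2Q.
  by have [/val_inj] := uniq_map_inj_in (uQ 2) uQ' c2Q erefl.
have [[[r1 c1] s1] /(bounded_ord bQ)[r' [c' [s' [-> -> -> uQ']]]]] :=
  mate 0 _ tP.
case=> /val_inj rr /val_inj cc; rewrite -rr -cc in uQ'.
exists s'; split=> [|s2 [_]].
  split=> //; move: uQ'; rewrite mem_ord_set => uQ'.
  by apply/eqP => ss; rewrite ss in uQ'; exact: PQ uQ'.
rewrite !mem_ord_set in uQ' * => s2Q.
by have [/val_inj] := uniq_map_inj_in (uQ 0) uQ' s2Q erefl.
Qed.

End OrdinalTriples.

(** Transfers a cycle of natural numbers below [p] to ordinals; the bound ensures that [insub] drops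
    no entry. *)
Lemma single_cycle_ord p (D : {set 'I_p}) (e : rel 'I_p) (l : seq nat)
    (e' : rel nat) :
  (forall y, (y \in l) -> y < p) -> (forall y :
    'I_p, (val y \in l) = (y \in D)) ->
  {in l &, forall y y', e' y y' ->
    forall (a a' : 'I_p), val a = y -> val a' = y' -> e a a'} ->
  ucycle e' l -> single_cycle D e.
Proof.
move=> lp lD ee' /andP[cl ul].
have El : map val (pmap (insub : nat -> option 'I_p) l) = l.
  rewrite (pmap_filter (insubK _)); apply/all_filterP/allP => y /lp yp.
  by rewrite insubT.
exists (pmap insub l) => [y|].
  by rewrite -lD -{2}El mem_map //; exact: val_inj.
rewrite /ucycle -(map_inj_uniq val_inj) El ul andbT.
rewrite -El cycle_map in cl.
have sl : all [in pmap (insub :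
  nat -> option 'I_p) l] (pmap insub l) by apply/allP.
apply: sub_in_cycle sl cl => a a' al al' /= /ee'; apply => //.
  by rewrite -El map_f.
by rewrite -El map_f.
Qed.

(** * Verification of the axioms of a spherical bitrade *)

Section Spherical.

Variables (m N : nat) (W B : seq triple).
Hypothesis WB : chain m N W B.
Hypothesis N_gt0 : 0 < N.

Let Ws : {set 'I_m * 'I_N.+1 * 'I_N.+1} := ord_set m N W.
Let Bs : {set 'I_m * 'I_N.+1 * 'I_N.+1} := ord_set m N B.

Lemma chain_disjointF t : t \in W -> t \in B -> False.
Proof. by move=> tW tB; case: (chain_disjoint WB tW tB) => _; lia. Qed.

Let bW : bounded m N W := chain_white_bound WB.
Let bB : bounded m N B := chain_black_bound WB.

Lemma chain_latin_bitrade :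
  latin_bitrade [set: 'I_m] [set: 'I_N.+1] [set: 'I_N.+1] Ws Bs.
Proof.
have mates_WB : mates_in Ws Bs.
  apply: mates_in_ord_set => //; first exact: chain_shadow_uniq_black WB.
    exact: chain_mate_white WB.
  exact: chain_disjointF.
have mates_BW : mates_in Bs Ws.
  apply: mates_in_ord_set => //; first exact: chain_shadow_uniq WB.
    exact: chain_mate_black WB.
  by move=> t tB tW; exact: chain_disjointF tW tB.
have [r0 [c0 [s0 [_ _ _ tB]]]] := bounded_ord bB (chain_end WB).
have [[r [[_ rW] _]] _ _] := mates_BW _ _ _ tB.
split=> //; first by split; apply/set0Pn; eexists; [exact: rW | exact: tB].
- apply: partial_latin_square_ord_set => //.
  + exact: chain_shadow_uniq WB.
  + by move=> x; rewrite -(chain_rows WB) => /mem_rows.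
  + by move=> x; rewrite -(chain_columns WB) => /mem_columns.
  + by move=> x; rewrite -(chain_symbols WB) => /mem_symbols.
apply: partial_latin_square_ord_set => //.
+ exact: chain_shadow_uniq_black WB.
+ move=> x; rewrite -(chain_rows WB) => /mem_rows[c [s tW]].
  by have [[[? ?] s'] bB' [-> _]] := chain_mate_white WB 0 tW; eexists;
    exists s'; exact: bB'.
+ move=> x; rewrite -(chain_columns WB) => /mem_columns[c [s tW]].
  by have [[[r' ?] s'] bB' [_ ->]] := chain_mate_white WB 0 tW; exists r', s'.
move=> x; rewrite -(chain_symbols WB) => /mem_symbols[c [s tW]].
by have [[[r' c'] s'] bB' [_ ->]] := chain_mate_white WB 1 tW; exists r', c'.
Qed.

(** Membership in a sub-bitrade is preserved across edges, hence constant on faces; a non-empty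
    proper [W'] would contain one white face and miss another. *)
Lemma chain_connected_bitrade : connected Ws Bs.
Proof.
move=> [Rs [Cs [Ss [W' [B' [[[/set0Pn[t0 t0W'] _] plsW' plsB' mWB mBW]]]]]]].
move=> /properP[W'W [t1 t1W t1W']] /properP[B'B _].
pose X (P : {set 'I_m * 'I_N.+1 * 'I_N.+1}) t :=
  exists2 u, u \in P & nat_triple u = t.
have [_ _ plsB mates_WB mates_BW] := chain_latin_bitrade.
have plsW : partial_latin_square [set: 'I_m] [set: 'I_N.+1] [set: 'I_N.+1] Ws.
  by have [] := chain_latin_bitrade.
(* The mate of [u] inside [Q'] lies in [Q] and shares two coordinates with [v], so it is [v]. Stated
   for arbitrary sets in order to serve both colours. *)
have old (P Q P' Q' : {set 'I_m * 'I_N.+1 * 'I_N.+1}) k u v :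
    partial_latin_square [set: 'I_m] [set: 'I_N.+1] [set: 'I_N.+1] Q ->
    P' \subset P -> Q' \subset Q -> mates_in P' Q' -> v \in Q ->
    shadow k (nat_triple u) = shadow k (nat_triple v) -> u \in P' -> v \in Q'.
  move=> plsQ P'P /subsetP Q'Q mPQ vQ;
    case: u v vQ => [[r c] s] [[r' c'] s'] vQ e.
  case/mPQ; case: k e => [|[|k]] [].
  - move=> /val_inj rr /val_inj cc _ _ [s1 [[_ uQ'] _]]; subst r' c'.
    suff -> : (r, c, s') = (r, c, s1) by [].
    by apply: (pls_inj plsQ vQ (Q'Q _ uQ')); rewrite /= !eqxx.
  - move=> /val_inj rr /val_inj cc [s1 [[_ uQ'] _]] _ _; subst c' s'.
    suff -> : (r', c, s) = (s1, c, s) by [].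
    by apply: (pls_inj plsQ vQ (Q'Q _ uQ')); rewrite /= !eqxx addn1 addnS.
  move=> /val_inj rr /val_inj cc _ [s1 [[_ uQ'] _]] _; subst r' s'.
  suff -> : (r, c', s) = (r, s1, s) by [].
  by apply: (pls_inj plsQ vQ (Q'Q _ uQ')); rewrite /= !eqxx addn1.
have [|p [Xp _]] := @chain_connected _ _ _ _ WB (X W') (X B').
  move=> k [[r c] s] [[r' c'] s'] /(bounded_ord bW)[r1 [c1 [s1 [-> -> -> wW]]]].
  case/(bounded_ord bB) => [r2 [c2 [s2 [-> -> -> wB]]]] e.
  split=> [[u uW' ueq]|[u uB' ueq]].
    exists (r2, c2, s2) => //.
    by apply: (old Ws Bs W' B' k u) => //; rewrite ueq.
  exists (r1, c1, s1) => //.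
  by apply: (old Bs Ws B' W' k u) => //; rewrite ueq.
have XW t : t \in Ws -> (t \in W') <-> p.
  move=> tW; rewrite -(Xp (nat_triple t)); last by move: tW; rewrite inE.
  by split=> [tW'|[u uW' /nat_triple_inj <-]]; first exists t.
by move/negP: t1W'; apply; apply/XW => //; apply/(XW t0) => //;
  exact: (subsetP W'W).
Qed.

Lemma chain_separated_bitrade : separated Ws Bs.
Proof.
split=> x.
- have [l lP] := chain_separated WB 0 x; rewrite !map_id in lP * => ul.
  apply: single_cycle_ord ul => [y|y|y y' _ _ /linkP[z zW zB] a a' ay ay'].
  + by rewrite lP => /mem_fibre[z /bW[_ _]].
  + rewrite lP !inE; apply/mem_fibre/existsP => [[z zW]|[z]]; last first.
      by rewrite mem_ord_set; exists (nat_of_ord z).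
    have [_ zN _] := bW zW; exists (Ordinal (zN : z < N.+1)).
    by rewrite mem_ord_set.
  have [_ zN _] := bW zW; apply/existsP; exists (Ordinal (zN : z < N.+1)).
  by rewrite !mem_ord_set /= -[nat_of_ord a]/(val a) -[nat_of_ord a']/(val a')
    ay ay' zW.
- have [l lP] := chain_separated WB 1 x => ul.
  apply: single_cycle_ord ul => [y|y|y y' _ _ /linkP[z]].
  + by rewrite lP => /mem_fibre[z]; rewrite mem_turn1 => /bW[].
  + rewrite lP !inE; apply/mem_fibre/existsP => [[z]|[z]]; last first.
      by rewrite mem_ord_set; exists (nat_of_ord z); rewrite mem_turn1.
    rewrite mem_turn1 => zW; have [_ _ zN] := bW zW.
    by exists (Ordinal (zN : z < N.+1)); rewrite mem_ord_set.
  rewrite !mem_turn1 => zW zB a a' ay ay'; have [_ _ zN] := bW zW.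
  apply/existsP; exists (Ordinal (zN : z < N.+1)).
  by rewrite !mem_ord_set /= -[nat_of_ord a]/(val a) -[nat_of_ord a']/(val a')
    ay ay' zW.
have [l lP] := chain_separated WB 2 x => ul.
apply: single_cycle_ord ul => [y|y|y y' _ _ /linkP[z]].
+ by rewrite lP => /mem_fibre[z]; rewrite mem_turn2 => /bW[].
+ rewrite lP !inE; apply/mem_fibre/existsP => [[z]|[z]]; last first.
    by rewrite mem_ord_set; exists (nat_of_ord z); rewrite mem_turn2.
  rewrite mem_turn2 => zW; have [zm _ _] := bW zW.
  by exists (Ordinal zm); rewrite mem_ord_set.
rewrite !mem_turn2 => zW zB a a' ay ay'; have [zm _ _] := bW zW.
apply/existsP; exists (Ordinal zm).
by rewrite !mem_ord_set /= -[nat_of_ord a]/(val a) -[nat_of_ord a']/(val a')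
  ay ay' zW.
Qed.

(** There are [m + 2 (N + 1)] vertices, and [chain_size] gives [m + 2 N] white triangles. *)
Lemma chain_spherical : spherical_bitrade Ws Bs.
Proof.
split; [exact: chain_latin_bitrade | exact: chain_connected_bitrade
  | exact: chain_separated_bitrade | apply/(euler_char_bitrade
    chain_latin_bitrade)].
rewrite card_ord_set ?(chain_uniq_white WB) // !card_ord (chain_size WB); lia.
Qed.

End Spherical.

(** * Labellings *)

Local Open Scope ring_scope.

(* Cancels the last summand against its opposite, moved next to it. *)
Ltac zmod_cancel :=
  match goal with
  | |- ?S + ?y - ?y = 0 => rewrite addrK
  | |- ?S - ?y + ?y = 0 => rewrite subrK
  | |- ?S - ?y = 0 => rewrite (addrAC _ y)
  | |- ?S + ?y = 0 => rewrite (addrAC _ (- y))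
  end.

(** Decides linear identities by moving everything to one side and expanding; the leading zero makes
    every term the right operand of a sum, so that cancellation is uniform. *)
Ltac zmod :=
  apply/eqP; rewrite -subr_eq0; apply/eqP;
  rewrite ?(mulr0n, mulrS) ?(opprD, opprK, oppr0, addr0, add0r) ?addrA;
  rewrite -[LHS]add0r ?addrA; repeat zmod_cancel; done.

Record labelling (M : Type) : Type := Labelling {
  row_label : nat -> M;
  column_label : nat -> M;
  symbol_label : nat -> M
}.

Section Labellings.

Variable M : zmodType.
Implicit Types (f g : labelling M) (P : seq triple).

Definition label_sum f r c s : M :=
  row_label f r + column_label f c + symbol_label f s.

Definition satisfies f P : Prop :=
  forall r c s, (r, c, s) \in P -> label_sum f r c s = 0.

(* The white relations added by inserting two spheres: the first contributes
   its white triangles except the one at its far end, to which the second is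
   glued by a black triangle of the reversed colouring. *)
Definition white_relations m N N1 N2 f : Prop :=
  [/\ forall i, (N < i < N1)%N -> label_sum f 0 i i = 0,
      forall i, (N <= i < N1)%N -> label_sum f m i i.+1 = 0
    & label_sum f m N1 N = 0] /\
  [/\ forall i, (N1 <= i <= N2)%N -> label_sum f m.+1 i i = 0,
      forall i, (N1 <= i < N2)%N -> label_sum f 0 i i.+1 = 0
    & label_sum f 0 N2 N1 = 0].

Definition agree m N f g : Prop :=
  [/\ forall r, (r < m)%N -> row_label f r = row_label g r,
      forall c, (c <= N)%N -> column_label f c = column_label g c
    & forall s, (s <= N)%N -> symbol_label f s = symbol_label g s].

End Labellings.

Lemma additive_exists (U V : zmodType) (f : U -> V) :
  {morph f : x y / x + y} -> exists g : {additive U -> V}, g =1 f.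
Proof.
move=> fD; have f0 : f 0 = 0 by apply: (addrI (f 0)); rewrite -fD !addr0.
have fB : zmod_morphism f.
  move=> x y; apply: (addIr (f y)); by rewrite -fD !subrK.
pose g : {additive U -> V} := HB.pack f (GRing.isZmodMorphism.Build U V f fB).
by exists g.
Qed.

(** * The relations added by two successive gluings *)

Section WhiteGrowth.

Variables (m N n n' : nat) (W B : seq triple).
Hypothesis WB : chain m N W B.
Hypothesis n_gt0 : (0 < n)%N.
Hypothesis n'_gt0 : (0 < n')%N.

Let N1 := (N + n)%N.
Let N2 := (N1 + n')%N.
Let W2 := grow_black m.+1 N1 n' (grow_white m N n W).

Let W2E r c s : ((r, c, s) \in W2) =
  [|| ((r, c, s) != (0%N, N1, N1)) &&
      [|| (r, c, s) \in W, [&& r == 0, s == c & N < c <= N1]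
        | [&& r == m, s == nxt N N1 c & N <= c <= N1]],
      [&& r == m.+1, s == c & N1 <= c <= N2]
    | [&& r == 0, s == nxt N1 N2 c & N1 <= c <= N2]]%N.
Proof.
by rewrite (grow_blackE n' (grow_chain WB n_gt0)) (grow_whiteE _ _ _).
Qed.

Lemma satisfies_grow (M : zmodType) (f : labelling M) :
  satisfies f W2 <-> satisfies f W /\ white_relations m N N1 N2 f.
Proof.
have m_gt0 := chain_m_gt0 WB.
split=> [fW2|[fW [[r1 r2 r3] [r4 r5 r6]]]].
  split=> [r c s tW|].
    apply: fW2; rewrite W2E tW andbT; apply/orP; left.
    by apply/eqP => -[rr cc ss]; have [] := chain_white_bound WB tW; lia.
  split; split=> [i iN|i iN|]; apply: fW2; rewrite W2E.
  + by apply/orP; left; apply/andP; split; [apply/eqP => -[]; lia | lia].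
  + have := nxtP N N1 i => ?.
    by apply/orP; left; apply/andP; split; [apply/eqP => -[]; lia | lia].
  + have := nxtP N N1 N1 => ?.
    by apply/orP; left; apply/andP; split; [apply/eqP => -[]; lia | lia].
  + lia.
  + have := nxtP N1 N2 i; lia.
  + have := nxtP N1 N2 N2; lia.
move=> r c s; rewrite W2E => /orP[/andP[neq]|/orP[]].
- case/or3P=> [/fW //||] /and3P[/eqP rE /eqP sE cN]; subst r s.
    by apply: r1; suff : c <> N1 by [lia]; move=> cE; rewrite cE eqxx in neq.
  by have [[->] ->|[? ->]] := nxtP N N1 c; [exact: r3 | apply: r2; lia].
- by case/and3P=> /eqP-> /eqP-> ?; exact: r4.
case/and3P=> /eqP-> /eqP-> ?.
by have [[->] ->|[? ->]] := nxtP N1 N2 c; [exact: r6 | apply: r5; lia].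
Qed.

End WhiteGrowth.

Section WhiteRelations.

Variables (M : zmodType) (m N n n' : nat) (f : labelling M).

Let N1 := (N + n.+1)%N.
Let N2 := (N1 + n'.+1)%N.
Let u := column_label f.
Let v := symbol_label f.
Let d := row_label f m - row_label f 0.
Let x := row_label f m.+1 - row_label f 0.

Hypothesis m_gt0 : (0 < m)%N.
Hypothesis rel_f : white_relations m N N1 N2 f.

(** On the first sphere the columns form a progression of difference [d], which determines the
    labels at [N1] and, through the triangle [(m.+1, N1, N1)], the value of [x]. On the second the
    symbols form a progression of difference [x] around a cycle of length [n'.+2], which closes
    up. *)
Lemma white_relations_row_succ :
  x = label_sum f 0 N N + d *+ n.+2 /\ x *+ n'.+2 = 0.
Proof.
have [[r1 r2 r3] [r4 r5 r6]] := rel_f.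
have symS i : (N <= i < N1)%N -> v i.+1 = - (row_label f m + u i).
  by move=> iN; rewrite -[LHS](subr0) -(r2 i iN) /label_sum -/u -/v; zmod.
have colE j : (j <= n)%N -> u (N + j)%N = u N + d *+ j.
  elim: j => [|j IHj] jn; first by rewrite addn0 addr0.
  have r1j : label_sum f 0 (N + j.+1) (N + j.+1) = 0 by apply: r1;
    rewrite /N1; lia.
  rewrite -[LHS]subr0 -r1j /label_sum -/u -/v addnS.
  rewrite symS ?IHj; try (rewrite /N1; lia).
  by rewrite /d; zmod.
have symN1 : v N1 = - (row_label f m + u N + d *+ n).
  by rewrite /N1 addnS symS ?colE ?addrA //; rewrite /N1; lia.
have colN1 : u N1 = - (row_label f m + v N).
  by rewrite -[LHS]subr0 -r3 /label_sum -/u -/v; zmod.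
have xE : x = label_sum f 0 N N + d *+ n.+2.
  have r4N : label_sum f m.+1 N1 N1 = 0 by apply: r4; rewrite /N2; lia.
  rewrite -[LHS]subr0 -r4N /x /label_sum -/u -/v colN1 symN1 /d; zmod.
split=> //.
have symE j : (j <= n'.+1)%N -> v (N1 + j)%N = v N1 + x *+ j.
  elim: j => [|j IHj] jn; first by rewrite addn0 addr0.
  have r5j : label_sum f 0 (N1 + j) (N1 + j).+1 = 0 by apply: r5; rewrite /N2;
    lia.
  have r4j : label_sum f m.+1 (N1 + j) (N1 + j) = 0 by apply: r4; rewrite /N2;
    lia.
  rewrite mulrSr addrA -IHj ?(ltnW jn) // addnS.
  rewrite -[LHS]addr0 -r4j -[LHS]subr0 -r5j /label_sum -/u -/v /x; zmod.
have r4n : label_sum f m.+1 N2 N2 = 0 by apply: r4; rewrite /N2; lia.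
have r6' := r6; rewrite /label_sum -/u -/v in r4n r6'.
rewrite [in v N2]/N2 symE // in r4n.
by rewrite -[LHS]addr0 -[X in _ + X]r6' -[LHS]subr0 -[X in _ - X]r4n /x; zmod.
Qed.

(** The old labels and the label of row [m] determine all new labels; this is the uniqueness half of
    the extension. *)
Lemma white_relations_rigid :
  agree m N f (Labelling (fun=> 0) (fun=> 0) (fun=> 0)) -> row_label f m = 0 ->
  agree m.+2 N2 f (Labelling (fun=> 0) (fun=> 0) (fun=> 0)).
Proof.
have [[r1 r2 r3] [r4 r5 r6]] := rel_f;
  rewrite /label_sum -/u -/v in r1 r2 r3 r4 r5 r6.
move=> [/= f0 u0 v0] fm; rewrite (f0 0 m_gt0) in r1 r5 r6; rewrite fm in r2 r3.
have vS i : (N <= i < N1)%N -> u i = 0 -> v i.+1 = 0.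
  by move=> /r2; rewrite add0r => + u_i; rewrite u_i add0r.
have uv j : (j <= n)%N -> u (N + j)%N = 0 /\ v (N + j)%N = 0.
  elim: j => [|j IHj] jn; first by rewrite addn0 [u N]u0 ?[v N]v0.
  have vj : v (N + j.+1)%N = 0.
    by rewrite addnS vS //; [rewrite /N1; lia | apply: (IHj _).1; lia].
  split=> //; have := r1 (N + j.+1)%N; rewrite vj add0r addr0; apply.
  by rewrite /N1; lia.
have vN1 : v N1 = 0.
  by rewrite /N1 addnS vS //; [rewrite /N1; lia | apply: (uv n _).1; lia].
have uN1 : u N1 = 0 by move: r3; rewrite [v N]v0 // add0r addr0.
have fm1 : row_label f m.+1 = 0.
  have := r4 N1; rewrite uN1 vN1 !addr0; apply; rewrite /N2; lia.
have u_v i : (N1 <= i <= N2)%N -> v i = 0 -> u i = 0.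
  by move=> /r4; rewrite fm1 add0r => + vi; rewrite vi addr0.
have uv' j : (j <= n'.+1)%N -> u (N1 + j)%N = 0 /\ v (N1 + j)%N = 0.
  elim: j => [|j IHj] jn; first by rewrite addn0.
  have [uj _] := IHj (ltnW jn).
  have vj : v (N1 + j.+1)%N = 0.
    have := r5 (N1 + j)%N; rewrite uj addr0 add0r addnS; apply; rewrite /N2;
      lia.
  by split=> //; apply: u_v => //; rewrite /N2; lia.
have uvN2 i : (i <= N2)%N -> u i = 0 /\ v i = 0.
  move=> iN2; have [iN|iN] := leqP i N; first by rewrite [u i]u0 ?[v i]v0.
  have [iN1|iN1] := leqP N1 i.
    by rewrite -(subnKC iN1); apply: uv'; move: iN2; rewrite /N2; lia.
  by rewrite -(subnKC (ltnW iN)); apply: uv; move: iN1; rewrite /N1; lia.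
split=> /= [r|c /uvN2[]|s /uvN2[]] //.
by rewrite ltnS leq_eqVlt => /predU1P[->//|];
  rewrite ltnS leq_eqVlt => /predU1P[->//|/f0].
Qed.

End WhiteRelations.

(** * Explicit extension of a labelling over two glued trades *)

Section Extension.

Variables (M : zmodType) (m N n n' : nat) (f : labelling M) (y : M).

Let N1 := (N + n.+1)%N.
Let N2 := (N1 + n'.+1)%N.
Let u := column_label f.
Let v := symbol_label f.
Let x := label_sum f 0 N N + y *+ n.+2.

(** The solution of the added relations with row 0 labelled 0, row [m] labelled [y] and row [m.+1]
    labelled [x]: a progression of difference [- y] on the first sphere, then one of difference [x]
    from [N1] on. *)
Definition extended_symbol i : M :=
  if (i <= N)%N then v i
  else if (i <= N1)%N then - y - u N - y *+ (i - N).-1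
  else - y - u N - y *+ n + x *+ (i - N1).

Definition extended_column i : M :=
  if (i <= N)%N then u i
  else if (i < N1)%N then u N + y *+ (i - N)
  else - x - extended_symbol i.

Definition extended_row r : M :=
  if r == m then y else if r == m.+1 then x else row_label f r.

Definition extension := Labelling extended_row extended_column extended_symbol.

Hypothesis m_gt0 : (0 < m)%N.
Hypothesis row0 : row_label f 0 = 0.
Hypothesis x_tors : x *+ n'.+2 = 0.

Lemma extension_agree : agree m N extension f.
Proof.
split=> i /= iN; rewrite /extended_row /extended_column /extended_symbol ?iN //.
by rewrite !ltn_eqF // ltnW.
Qed.

Lemma extension_relations : white_relations m N N1 N2 extension.
Proof.
have r0 : extended_row 0 = 0%R by have [/(_ 0 m_gt0) r0 _ _] :=
  extension_agree; exact: etrans r0 row0.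
have rm : extended_row m = y by rewrite /extended_row eqxx.
have rm1 : extended_row m.+1 = x by rewrite /extended_row gtn_eqF // eqxx.
have symN1 j : extended_symbol (N1 + j)%N = - y - u N - y *+ n + x *+ j.
  rewrite /extended_symbol leqNgt (_ : N < N1 + j)%N /=; last by rewrite /N1;
    lia.
  case: leqP => [j0|_]; last by rewrite addKn.
  have -> : j = 0%N by lia.
  by rewrite addn0 /N1 addKn addr0.
have symN j : (j <= n)%N -> extended_symbol (N + j).+1 = - y - u N - y *+ j.
  move=> jn; rewrite /extended_symbol leqNgt ltnS leq_addr /=.
  by rewrite -addnS /N1 leq_add2l ltnS jn addKn.
have colN j : (j <= n)%N -> extended_column (N + j)%N = u N + y *+ j.
  move=> jn; rewrite /extended_column /N1 ltn_add2l ltnS jn addKn.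
  by case: leqP => // j0; have -> : j = 0%N by [lia]; rewrite addn0 addr0.
have colN1 i : (N1 <= i)%N -> extended_column i = - x - extended_symbol i.
  move=> iN; rewrite /extended_column leqNgt (_ : N < i)%N /=; last first.
    by apply: leq_trans iN; rewrite /N1; lia.
  by rewrite ltnNge iN.
rewrite /white_relations /label_sum /= r0 rm rm1.
split; split=> [i iN|i iN|].
- have [j iE] : exists j, i = (N + j).+1 by exists (i - N.+1)%N; lia.
  subst i; rewrite -{1}addnS colN ?symN; try by move: iN; rewrite /N1; lia.
  zmod.
- have [j iE] : exists j, i = (N + j)%N by exists (i - N)%N; lia.
  by subst i; rewrite colN ?symN; first zmod; move: iN; rewrite /N1; lia.
- rewrite colN1 // -[in extended_symbol N1](addn0 N1) symN1 mulr0n addr0.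
  rewrite /extended_symbol leqnn /x /label_sum row0 -/u -/v; zmod.
- have [j iE] : exists j, i = (N1 + j)%N by exists (i - N1)%N; lia.
  by subst i; rewrite colN1 ?leq_addr //; zmod.
- have [j iE] : exists j, i = (N1 + j)%N by exists (i - N1)%N; lia.
  by subst i; rewrite colN1 ?leq_addr // -addnS !symN1; zmod.
rewrite colN1 ?leq_addr // -[in extended_symbol N1](addn0 N1) !symN1.
(* The relation closing the second cycle is where [x_tors] enters. *)
have -> : x *+ 0 = x *+ n'.+2 by [].
zmod.
Qed.

End Extension.

(** The shifts [a] and [b] cancel in every relation; they account for the free part of rank 2. *)
Definition affine_image (U V : zmodType) (phi : {additive U -> V}) a b
    (l : labelling U) : labelling V :=
  Labelling (fun r => phi (row_label l r) + a)
            (fun c => phi (column_label l c) + b)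
            (fun s => phi (symbol_label l s) - (a + b)).

(* [C] is the group presented by the relations of [W] on the labels
   normalised to vanish at row [0] and column [0]. *)
Record universal m N W (C : zmodType) (l : labelling C) : Prop := Universal {
  universal_row0 : row_label l 0 = 0;
  universal_column0 : column_label l 0 = 0;
  universal_sat : satisfies l W;
  universal_factor : forall (M : zmodType) (f : labelling M), satisfies f W ->
    exists phi : {additive C -> M},
      agree m N f (affine_image phi (row_label f 0) (column_label f 0) l);
  universal_unique : forall (M : zmodType) (phi : {additive C -> M}),
    agree m N (Labelling (phi \o row_label l) (phi \o column_label l)
                         (phi \o symbol_label l))
              (Labelling (fun=> 0) (fun=> 0) (fun=> 0)) ->
    phi =1 fun=> 0
}.

Lemma universal_base :
  universal 1 0 [:: (0%N, 0%N, 0%N)]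
    (Labelling (fun=> 0 : 'I_1) (fun=> 0) (fun=> 0)).
Proof.
split=> //.
- by move=> r c s _; rewrite /label_sum !addr0.
- move=> M f fW; have [phi phi0] : exists phi :
    {additive 'I_1 -> M}, phi =1 fun=> 0.
    by apply: additive_exists => x y; rewrite addr0.
  exists phi; split=> /= i; rewrite ?ltnS leqn0 => /eqP->;
    rewrite phi0 add0r //.
  have := fW 0%N 0%N 0%N (mem_head _ _); rewrite /label_sum => /eqP.
  by rewrite addrC addr_eq0 => /eqP.
by move=> M phi _ x; rewrite (ord1 x) raddf0.
Qed.

Lemma satisfies_agree (M : zmodType) m N W B (f g : labelling M) :
  chain m N W B -> agree m N f g -> satisfies g W -> satisfies f W.
Proof.
move=> WB [rE cE sE] gW r c s tW; have [? ? ?] := chain_white_bound WB tW.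
by rewrite /label_sum rE ?cE ?sE //; exact: gW.
Qed.

Lemma pair_mulrn (U V : zmodType) (a : U) (b : V) j :
  ((a, b) : U * V) *+ j = (a *+ j, b *+ j).
Proof. by elim: j => // j IHj; rewrite !mulrS IHj. Qed.

Lemma satisfies_affine_image (U V : zmodType) (phi :
  {additive U -> V}) a b l P :
  satisfies l P -> satisfies (affine_image phi a b l) P.
Proof.
move=> lP r c s /lP; rewrite /label_sum /= => /(congr1 phi).
by rewrite raddf0 !(raddfD phi) => <-; zmod.
Qed.

Definition sub_labelling (M : zmodType) (f g : labelling M) : labelling M :=
  Labelling (fun r => row_label f r - row_label g r)
            (fun c => column_label f c - column_label g c)
            (fun s => symbol_label f s - symbol_label g s).

Lemma satisfies_sub (M : zmodType) (f g : labelling M) P :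
  satisfies f P -> satisfies g P -> satisfies (sub_labelling f g) P.
Proof.
move=> fP gP r c s tP; rewrite -[RHS]subr0 -{1}(fP _ _ _ tP) -(gP _ _ _ tP).
by rewrite /label_sum /=; zmod.
Qed.

Lemma agree_sub (M : zmodType) m N (f g : labelling M) :
  agree m N (sub_labelling f g) (Labelling (fun=> 0) (fun=> 0) (fun=> 0)) <->
  agree m N f g.
Proof.
split=> -[rE cE sE]; split=> i /= iN; apply/eqP.
- by rewrite -subr_eq0; apply/eqP/rE.
- by rewrite -subr_eq0; apply/eqP/cE.
- by rewrite -subr_eq0; apply/eqP/sE.
- by rewrite subr_eq0; apply/eqP/rE.
- by rewrite subr_eq0; apply/eqP/cE.
- by rewrite subr_eq0; apply/eqP/sE.
Qed.

(** * Splitting off a cyclic summand *)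

Section UniversalGrowth.

Variables (m N n n' k : nat) (W B : seq triple) (C : zmodType).
Variables (l : labelling C) (z : C).
Hypothesis WB : chain m N W B.
Hypothesis lW : universal m N W l.
Hypothesis k_eq : k = (n.+2 * n'.+2)%N.

Let N1 := (N + n.+1)%N.
Let N2 := (N1 + n'.+1)%N.
Let W2 := grow_black m.+1 N1 n'.+1 (grow_white m N n.+1 W).
Let tau := label_sum l 0 N N.

Hypothesis z_eq : tau *+ n'.+2 = z *+ k.

Let D : zmodType := (C * 'Z_k)%type.
(** The label of row [m]. The component [- z] makes [tau + n.+2 y] vanish when multiplied by
    [n'.+2], and [y + (z, 0)] generates the new summand. *)
Let y : D := (- z, 1).
Let l0 : labelling D := Labelling (fun r => (row_label l r, 0))
  (fun c => (column_label l c, 0)) (fun s => (symbol_label l s, 0)).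

Definition grown_labelling : labelling D := extension m N n l0 y.

Lemma additive_Zp (M : zmodType) (w : M) : w *+ k = 0 ->
  {morph (fun i : 'Z_k => w *+ i) : i j / i + j}.
Proof.
move=> wk i j; have k_gt1 : (1 < k)%N by rewrite k_eq; lia.
rewrite -mulrnDr /= [X in (_ %% X)%N]Zp_cast //.
by rewrite [in RHS](divn_eq (i + j) k) mulrnDr mulnC mulrnA wk mul0rn add0r.
Qed.

Lemma Zp_natr_k : k%:R = 0 :> 'Z_k.
Proof. by apply: pchar_Zp; rewrite k_eq; lia. Qed.

Let m_gt0 : (0 < m)%N := chain_m_gt0 WB.

Let l0_sum r c s : label_sum l0 r c s = (label_sum l r c s, 0).
Proof.
rewrite (_ : label_sum l0 r c s = (label_sum l r c s, 0 + 0 + 0)) //.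
by rewrite !addr0.
Qed.

Let x := label_sum l0 0 N N + y *+ n.+2.

Let x_tors : x *+ n'.+2 = 0.
Proof.
rewrite /x l0_sum mulrnDl -mulrnA -k_eq !pair_mulrn mul0rn Zp_natr_k z_eq.
rewrite (_ : _ + _ = (z *+ k + (- z) *+ k, 0 + 0)) //.
by rewrite mulNrn subrr addr0.
Qed.

Lemma grown_universal : universal m.+2 N2 W2 grown_labelling.
Proof.
have l0_row0 : row_label l0 0 = 0 by rewrite /= (universal_row0 lW).
have aE := extension_agree m N n l0 y.
have [aEr aEc aEs] := aE.
have relE := @extension_relations D m N n n' l0 y m_gt0 l0_row0 x_tors.
have growE (M : zmodType) (f : labelling M) :=
  satisfies_grow WB (isT : 0 < n.+1)%N (isT : 0 < n'.+1)%N f.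
split.
- by rewrite /grown_labelling aEr.
- by rewrite /grown_labelling aEc //= (universal_column0 lW).
- apply/growE; split=> //; apply: satisfies_agree WB aE _ => r c s tW.
  by rewrite l0_sum (universal_sat lW).
- move=> M f fW2; have [fW relf] := (growE _ f).1 fW2.
  have [phi [phir phic phis]] := universal_factor lW fW.
  have [x_eq xt] := white_relations_row_succ m_gt0 relf.
  set d := row_label f m - row_label f 0 in x_eq.
  (* The forced image of [(0, 1)], since [y] must go to [d]. It is killed by [k] because [k w]
     equals [n'.+2] times the value of [x] for [f], which is 0. *)
  pose w := d + phi z.
  have wk : w *+ k = 0.
    have tauE : label_sum f 0 N N = phi tau.
      rewrite /label_sum phic // phis //= !(raddfD phi).
      by rewrite (universal_row0 lW) raddf0; zmod.
    rewrite mulrnDl -raddfMn -z_eq raddfMn -tauE k_eq mulrnA -mulrnDl addrC.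
    by rewrite -x_eq.
  have [psi psiE] : exists psi : {additive D -> M}, psi =1 fun a =>
    phi a.1 + w *+ a.2.
    apply: additive_exists => a b; rewrite /= raddfD additive_Zp //.
    by rewrite addrACA.
  have psi0 a : psi (a, 0) = phi a by rewrite psiE /= addr0.
  have sat_l' : satisfies grown_labelling W2.
    apply/growE; split=> //; apply: satisfies_agree WB aE _ => r c s tW.
    by rewrite l0_sum (universal_sat lW).
  (* The difference of [f] and its candidate vanishes on the old labels and at row [m], so rigidity
     applies to it. *)
  exists psi; apply/agree_sub; set g := sub_labelling _ _.
  have [_ relg] := (growE _ g).1
    (satisfies_sub fW2 (satisfies_affine_image psi _ _ sat_l')).
  apply: (white_relations_rigid m_gt0 relg).
    apply/agree_sub; split=> i iN /=.
    - by rewrite [extended_row _ _ _ _ _ _]aEr // psi0 phir.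
    - by rewrite [extended_column _ _ _ _ _]aEc // psi0 phic.
    by rewrite [extended_symbol _ _ _ _ _]aEs // psi0 phis.
  rewrite /= /extended_row eqxx psiE /= raddfN.
  rewrite Zp_cast ?modn_small ?mulr1n; try by [rewrite k_eq; lia].
  by rewrite /w /d; zmod.
move=> M phi [phir phic phis] [a b].
have [psi psiE] : exists psi : {additive C -> M}, psi =1 fun a => phi (a, 0).
  by apply: additive_exists => a1 a2; rewrite -raddfD; congr (phi (_, _));
    rewrite addr0.
have phi0 c : phi (c, 0) = 0.
  rewrite -psiE; apply: (universal_unique lW) => //.
  split=> i iN /=; rewrite psiE.
  - have := phir i; rewrite /= [extended_row _ _ _ _ _ _]aEr //=; apply; lia.
  - have := phic i; rewrite /= [extended_column _ _ _ _ _]aEc //=; apply.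
    by rewrite /N2 /N1; lia.
  have := phis i; rewrite /= [extended_symbol _ _ _ _ _]aEs //=; apply.
  by rewrite /N2 /N1; lia.
have phiy : phi y = 0.
  by have := phir m; rewrite /= /extended_row eqxx; apply; lia.
have phi1 : phi (0, 1) = 0.
  have := raddfD phi y (z, 0); rewrite phiy phi0 addr0 => <-; congr (phi _).
  rewrite (_ : y + (z, 0) = (- z + z, 1 + 0)) //.
  by rewrite addNr addr0.
have -> : (a, b) = (a, 0) + (0, 1) *+ b :> D.
  rewrite pair_mulrn mul0rn natr_Zp.
  rewrite (_ : (a, 0) + (0, b) = (a + 0, 0 + b)) //.
  by rewrite addr0 add0r.
by rewrite raddfD raddfMn phi1 mul0rn phi0 addr0.
Qed.

(** The triangle [(m.+1, N2, N2)] shows that the new end value is [- x]. *)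
Lemma grown_label_sum_end : label_sum grown_labelling 0 N2 N2 *+ n'.+2 = 0.
Proof.
have l0_row0 : row_label l0 0 = 0 by rewrite /= (universal_row0 lW).
have [_ [r4 _ _]] := @extension_relations D m N n n' l0 y m_gt0 l0_row0 x_tors.
have [aEr _ _] := extension_agree m N n l0 y.
have r4N := r4 N2; rewrite leqnn leq_addr in r4N.
have -> : label_sum grown_labelling 0 N2 N2 = - x;
  last by rewrite mulNrn x_tors oppr0.
rewrite -[LHS]subr0 -(r4N isT) /label_sum {1}/grown_labelling aEr // l0_row0.
rewrite (_ : row_label _ m.+1 = x); first by zmod.
by rewrite /= /extended_row gtn_eqF // eqxx.
Qed.

End UniversalGrowth.

(** * Canonical groups *)

Section CanonicalGroup.

Local Open Scope quotient_scope.

Variables (m N : nat) (W : seq triple) (C : zmodType) (l : labelling C).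
Hypothesis bW : bounded m N W.
Hypothesis m_gt0 : (0 < m)%N.
Hypothesis lW : universal m N W l.
Hypothesis C_torsion : forall c : C, exists2 e, (0 < e)%N & c *+ e = 0.

Let Ws := ord_set m N W.
Let V := ('I_m + 'I_N.+1 + 'I_N.+1)%type.
Let F := {ffun V -> int}.
Let A : zmodType := presented_group Ws.
Let H : zmodType := (C * (int * int))%type.

Let cl (v : V) : A := \pi_A (generator v : F).

(** The integer pairs [(1, 0)], [(0, 1)] and [(-1, -1)] sum to zero on each triple and detect the
    free part of the presented group. *)
Let lab (v : V) : H :=
  match v with
  | inl (inl r) => (row_label l r, (1, 0))
  | inl (inr c) => (column_label l c, (0, 1))
  | inr s => (symbol_label l s, (-1, -1))
  end.

Let L (g : F) : H := \sum_v lab v *~ g v.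

Let LD : {morph L : g h / g + h}.
Proof.
by move=> g h; rewrite /L -big_split; apply: eq_bigr => v _;
  rewrite ffunE mulrzDr.
Qed.

Let L_additive : zmod_morphism L.
Proof.
by move=> g h; rewrite /L -sumrB; apply: eq_bigr => v _; rewrite !ffunE mulrzBr.
Qed.

HB.instance Definition _ := GRing.isZmodMorphism.Build F H L L_additive.

Let L_generator v : L (generator v) = lab v.
Proof.
rewrite /L (bigD1 v) //= big1 ?addr0 => [|u /negPf uv];
  rewrite ffunE ?eqxx ?uv //.
Qed.

Let L_relator t : t \in Ws -> L (relator t) = 0.
Proof.
case: t => [[r c] s]; rewrite mem_ord_set => tW.
rewrite /relator /= !LD !L_generator /=.
have := universal_sat lW tW; rewrite /label_sum => e.
rewrite (_ : _ + _ = (row_label l r + column_label l c + symbol_label l s, 0))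
  //.
by rewrite e.
Qed.

Let L_span g : g \in int_span Ws (@relator _ _ _) -> L g = 0.
Proof.
move=> /asboolP[a ->]; rewrite raddf_sum big1 // => t tW.
by rewrite raddfMz /= L_relator ?mul0rz.
Qed.

(** The map induced by [L] on the quotient, computed on a chosen representative; the choice is
    immaterial because [L] kills the relators. *)
Let iota (a : A) : H := L (generic_quotient.repr a).

Let iotaE g : iota (\pi_A g) = L g.
Proof.
apply/eqP; rewrite -subr_eq0 -raddfB; apply/eqP/L_span.
by rewrite Quotient.idealrBE reprK.
Qed.

Let iotaD : {morph iota : a b / a + b}.
Proof.
move=> a b; rewrite -[a]reprK -[b]reprK -raddfD !iotaE.
by rewrite LD.
Qed.

Let pi_span (g : F) : g \in int_span Ws (@relator _ _ _) -> \pi_A g = 0.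
Proof.
move=> gS; rewrite -[RHS](raddf0 (\pi_(Quotient.quot (int_span Ws (@relator _
  _ _))))).
by apply/eqP; rewrite -Quotient.idealrBE subr0.
Qed.

Let cl_relation r c s : (r, c, s) \in Ws ->
  cl (inl (inl r)) + cl (inl (inr c)) + cl (inr s) = 0.
Proof.
move=> tW; rewrite /cl -!raddfD; apply/pi_span/asboolP.
exists (fun t => (t == (r, c, s))%:R).
rewrite (bigD1 (r, c, s)) //= big1 ?addr0 ?eqxx // => t /andP[_ /negPf->].
by rewrite mulr0z.
Qed.

Let free_decomposition (g : F) : g = \sum_v generator v *~ g v.
Proof.
apply/ffunP => u; rewrite sum_ffunE (bigD1 u) //= big1 ?addr0 => [|v /negPf vu].
  by rewrite ffunMzE ffunE eqxx intz.
by rewrite ffunMzE ffunE eq_sym vu mul0rz.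
Qed.

(* Out of range labels are junk. *)
Let gens : labelling A := Labelling
  (fun i => if insub i is Some r then cl (inl (inl r)) else 0)
  (fun i => if insub i is Some c then cl (inl (inr c)) else 0)
  (fun i => if insub i is Some s then cl (inr s) else 0).

Let gens_sat : satisfies gens W.
Proof.
move=> r c s tW; have [r' [c' [s' [-> -> -> tS]]]] := bounded_ord bW tW.
by rewrite /label_sum /= !valK cl_relation.
Qed.

(** The map [iota] embeds the presented group in the sum of [C] and two copies of the integers. A
    torsion element has zero integer coordinates, and conversely [phi] maps the torsion group [C]
    onto the elements with image [(c, 0)]. *)
Lemma canonical_group_iso :
  exists2 h : canonical_group Ws -> C, bijective h & {morph h : a b / a + b}.
Proof.
have [phi [phir phic phis]] := universal_factor lW gens_sat.
pose r0 : 'I_m := Ordinal m_gt0.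
have gr0 : row_label gens 0 = cl (inl (inl r0)).
  by rewrite /= -[0%N]/(val r0) valK.
have gc0 : column_label gens 0 = cl (inl (inr ord0)).
  by rewrite /= -[0%N]/(val (ord0 : 'I_N.+1)) valK.
pose psi (x : H) := phi x.1 + cl (inl (inl r0)) *~ x.2.1 + cl (inl (inr ord0))
  *~ x.2.2.
have psiD : {morph psi : x y / x + y}.
  move=> x y; rewrite /psi /= raddfD !mulrzDr.
  by rewrite [in RHS]addrACA [in X in _ = X + _]addrACA.
have psi_lab v : psi (lab v) = cl v.
  rewrite /psi; case: v => [[r|c]|s] /=.
  - have /= := phir r (ltn_ord r); rewrite valK -gr0 => ->.
    by rewrite mulr1z mulr0z addr0.
  - have /= := phic c (ltn_ord c); rewrite valK -gc0 => ->.
    by rewrite mulr1z mulr0z addr0.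
  have /= := phis s (ltn_ord s); rewrite valK -gr0 -gc0 => ->.
  by rewrite !mulrN1z -addrA -opprD.
have [psi' psi'E] := additive_exists psiD.
have psiK a : psi (iota a) = a.
  rewrite -[a]reprK iotaE -psi'E /L raddf_sum [in RHS](free_decomposition
    (generic_quotient.repr a)).
  rewrite raddf_sum; apply: eq_bigr => v _.
  by rewrite !raddfMz psi'E psi_lab.
have iota_cl v : iota (cl v) = lab v by rewrite iotaE L_generator.
have [iota' iota'E] := additive_exists iotaD.
have phiK c : iota (phi c) = (c, 0).
  (* The defect [theta] vanishes on all labels, which generate [C], hence it is zero. *)
  have [theta thetaE] : exists theta : {additive C -> H},
      theta =1 fun c => iota (phi c) - (c, 0).
    apply: additive_exists => x y; rewrite raddfD iotaD.
    rewrite (_ : (x + y, 0) = (x, 0) + (y, 0) :> H);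
      first by rewrite opprD addrACA.
    by rewrite (_ : (x, 0) + (y, 0) = (x + y, 0 + 0)) // addr0.
  apply/eqP; rewrite -subr_eq0 -thetaE; apply/eqP/(universal_unique lW).
  split=> i iN /=; rewrite thetaE.
  - have e : row_label gens i = phi (row_label l i) + row_label gens 0 :=
      phir i iN.
    move: e; rewrite gr0 /= (insubT (fun r => r < m)%N iN) => /(congr1 iota).
    rewrite iotaD !iota_cl /= (universal_row0 lW) => /eqP.
    rewrite -subr_eq => /eqP <-; set a := row_label l i.
    rewrite (_ : _ - _ = (a - 0 - a, (1 - 1 - 0, 0 - 0 - 0))) //.
    by rewrite !subr0 !subrr.
  - have e : column_label gens i = phi (column_label l i) + column_label gens
      0 :=
      phic i iN.
    move: e; rewrite gc0 /= (insubT (fun c => c < N.+1)%N iN) => /(congr1 iota).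
    rewrite iotaD !iota_cl /= (universal_column0 lW) => /eqP.
    rewrite -subr_eq => /eqP <-; set a := column_label l i.
    rewrite (_ : _ - _ = (a - 0 - a, (0 - 0 - 0, 1 - 1 - 0))) //.
    by rewrite !subr0 !subrr.
  have e : symbol_label gens i =
    phi (symbol_label l i) - (row_label gens 0 + column_label gens 0) :=
      phis i iN.
  move: e; rewrite gr0 gc0 /= (insubT (fun c => c < N.+1)%N iN) => /esym/eqP.
  rewrite subr_eq => /eqP.
  move=> /(congr1 iota) ->; rewrite !iotaD !iota_cl /=.
  rewrite (universal_row0 lW) (universal_column0 lW); set a := symbol_label l i.
  rewrite (_ : _ - _ = (a + (0 + 0) - a, (-1 + (1 + 0) - 0, -1 + (0 + 1) -
    0))) //.
  by rewrite !addr0 subrr.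
have tors c : phi c \in torsion (A := A).
  by apply/asboolP; have [e e0 ce] := C_torsion c; exists e;
    rewrite // -raddfMn ce raddf0.
pose h (a : canonical_group Ws) : C := (iota (torsion_val a)).1.
exists h; last by move=> a b; rewrite /h /= iotaD.
exists (fun c => TorsionElement (tors c)) => [[a aT]|c];
  last by rewrite /h /= phiK.
apply: val_inj => /=; rewrite /h /=; apply: (can_inj psiK); rewrite phiK.
have /asboolP[e e0 ae] := aT.
have : iota a *+ e = 0 by rewrite -iota'E -raddfMn ae raddf0.
case: (iota a) => c [i j] /=.
have pairMn k : ((c, (i, j)) : H) *+ k = (c *+ k, (i *+ k, j *+ k)).
  by rewrite !pair_mulrn.
rewrite pairMn => -[_ /eqP + /eqP]; rewrite !mulrn_eq0 eqn0Ngt e0 /=.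
by move=> /eqP-> /eqP->.
Qed.

End CanonicalGroup.

Lemma composite_splitting (C : zmodType) (tau : C) (q k : nat) :
  composite k -> prime q -> tau *+ q = 0 ->
  exists n n' (z : C), [/\ k = (n.+2 * n'.+2)%N, prime n'.+2
                         & tau *+ n'.+2 = z *+ k].
Proof.
move=> /andP[k_gt1 k_nprime] q_prime tau_q.
have split p : prime p -> (p %| k)%N ->
    exists n n', [/\ p = n'.+2 & k = (n.+2 * n'.+2)%N].
  move=> p_prime /dvdnP[b kE]; have p_gt1 := prime_gt1 p_prime.
  (* The cofactor is at least 2 because [k] is not prime. *)
  case: b kE => [|[|b]] kE; first by rewrite kE in k_gt1.
    by rewrite kE mul1n p_prime in k_nprime.
  by exists b, p.-2; have pE : p = p.-2.+2 by [lia]; rewrite -pE.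
have [q_k|q_nk] := boolP (q %| k)%N.
  have [n [n' [qE kE]]] := split q q_prime q_k.
  (* With [q] itself as second factor, [tau] is already killed and [z] may be 0. *)
  by exists n, n', 0; rewrite mul0rn; rewrite -qE in kE *.
have p_prime := pdiv_prime k_gt1.
have [n [n' [pE kE]]] := split _ p_prime (pdiv_dvd k).
(* As [k] is invertible on the q-torsion, [tau] is divisible by [k]. *)
have /(coprimeP _ (ltnW k_gt1))[[u v] /= uv] : coprime k q.
  by rewrite coprime_sym prime_coprime.
exists n, n', (tau *+ (u * n'.+2)); split=> //; first by rewrite -pE.
rewrite -mulrnA -mulnA (mulnC n'.+2) mulnA mulrnA; congr (_ *+ _).
have -> : (u * k = 1 + v * q)%N by lia.
by rewrite mulrnDr mulnC mulrnA tau_q mul0rn addr0.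
Qed.

(** * Induction on the number of cyclic summands *)

Section MainInduction.

Variables (k : nat) (n : 'I_k -> nat).
Hypothesis n_composite : forall i, composite (n i).

(** Coordinates are defined for all indices, with conditions imposed only below the current stage;
    this avoids products over a varying index set. The equality test transports [c.2] to the type at
    [i]. *)
Definition cons_coordinate (C : zmodType) (j : 'I_k)
    (h : C -> forall i, 'Z_(n i)) (c : C * 'Z_(n j)) (i : 'I_k) : 'Z_(n i) :=
  match j =P i with
  | ReflectT e => ecast i 'Z_(n i) e c.2
  | ReflectF _ => h c.1 i
  end.

Lemma cons_coordinate_eq (C : zmodType) j (h : C -> forall i, 'Z_(n i)) c :
  cons_coordinate (j := j) h c j = c.2.
Proof.
by rewrite /cons_coordinate; case: eqP => // e; rewrite eq_axiomK.
Qed.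

Lemma cons_coordinate_neq (C : zmodType) j (h : C -> forall i, 'Z_(n i)) c i :
  j != i -> cons_coordinate (j := j) h c i = h c.1 i.
Proof. by rewrite /cons_coordinate; case: eqP. Qed.

(** The invariant keeps a prime [q] killing the end value, which allows the next splitting. Through
    [h], the group [C] is the sum of the first [j] cyclic groups. *)
Lemma chain_exists j : (j <= k)%N ->
  exists m N W B (C : zmodType) (l : labelling C) (q : nat)
    (h : C -> forall i, 'Z_(n i)),
  [/\ chain m N W B, (0 < j -> 0 < N)%N, universal m N W l,
      prime q /\ label_sum l 0 N N *+ q = 0
    & forall c : C, exists2 e, (0 < e)%N & c *+ e = 0] /\
  [/\ forall i, {morph h^~ i : c d / c + d},
      forall c, (forall i : 'I_k, (i < j)%N -> h c i = 0) -> c = 0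
    & forall v : forall i, 'Z_(n i),
        exists c, forall i : 'I_k, (i < j)%N -> h c i = v i].
Proof.
elim: j => [_|j IHj lt_jk].
  exists 1%N, 0%N, [:: (0%N, 0%N, 0%N)], [:: (0%N, 0%N, 0%N)], 'I_1.
  (* Any prime would do, the end value being 0 in the trivial group. *)
  exists (Labelling (fun=> 0) (fun=> 0) (fun=> 0)), 2%N, (fun _ _ => 0).
  split; split=> //.
  - exact: chain_base.
  - exact: universal_base.
  - by split=> //; rewrite /label_sum !addr0 mul0rn.
  - by move=> c; exists 1%N; rewrite // (ord1 c).
  - by move=> i c d; rewrite addr0.
  - by move=> c _; rewrite (ord1 c).
  by move=> v; exists 0.
have [m [N [W [B [C [l [q [h [[WB N_gt0 lW [q_prime tau_q] tors] [hD h_inj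
  h_surj]]]]]]]]]]
  := IHj (ltnW lt_jk).
pose j' : 'I_k := Ordinal lt_jk.
have [b [p [z [nE p_prime zE]]]] :=
  composite_splitting (n_composite j') q_prime tau_q.
(* Each gluing exchanges the colours; two of them restore the orientation and contribute one
   summand. The prime [p.+2] takes over the role of [q]. *)
have W1B1 := grow_chain WB (isT : 0 < b.+1)%N.
have W2B2 := grow_chain W1B1 (isT : 0 < p.+1)%N.
have n_gt1 : (1 < n j')%N by have /andP[] := n_composite j'.
exists m.+2, (N + b.+1 + p.+1)%N; do 2 eexists; exists (C * 'Z_(n j'))%type.
exists (grown_labelling m N b (n j') l z), p.+2, (cons_coordinate (j := j') h).
split; split.
- exact: W2B2.
- by move=> _; rewrite !addnS.
- exact: grown_universal WB lW nE zE.
- by split=> //; exact: grown_label_sum_end WB lW nE zE.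
- move=> [c d]; have [e e_gt0 ce] := tors c; exists (e * n j')%N.
    by rewrite muln_gt0 e_gt0 ltnW.
  by rewrite pair_mulrn mulrnA ce mul0rn mulnC mulrnA -(mulr_natr d) pchar_Zp
    // mulr0 mul0rn.
- move=> i c d; have [ij|ji] := eqVneq j' i; last first.
    by rewrite !cons_coordinate_neq // hD.
  by case: _ / ij; rewrite !cons_coordinate_eq.
- move=> [c d] cd0; have dE :
    d = 0 by rewrite -[LHS](cons_coordinate_eq h (c, d)) cd0 /=.
  rewrite dE (h_inj c) // => i lt_ij; rewrite -[RHS](cd0 i (ltnW lt_ij)).
  by rewrite cons_coordinate_neq // neq_ltn lt_ij orbT.
move=> v; have [c cE] := h_surj v; exists (c, v j') => i.
rewrite ltnS leq_eqVlt => /predU1P[ij|lt_ij]; last first.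
  by rewrite cons_coordinate_neq ?cE // neq_ltn lt_ij orbT.
have {}ij : j' = i by apply: val_inj.
by case: _ / ij; rewrite cons_coordinate_eq.
Qed.

End MainInduction.

Local Close Scope ring_scope.

(* The group law of 'Z_m is addition, and that of the dffun type is pointwise. *)
Theorem theorem2p5 (k : nat) (n : 'I_k -> nat) (Gamma : groupType) :
  0 < k ->
  (forall i, composite (n i)) ->
  isomorphic Gamma {dffun forall i : 'I_k, 'Z_(n i)} ->
  exists (R C S : finType) (W B : {set R * C * S}),
    spherical_bitrade W B /\
    isomorphic (Algebra.to_multiplicative (canonical_group W)) Gamma.
Proof.
move=> k_gt0 n_composite [f [finv fK finvK] fM].
have [m [N [W [B [C [l [q [h [[WB N_gt0 lW _ tors] [hD h_inj h_surj]]]]]]]]]]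
  := chain_exists n_composite (leqnn k).
have m_gt0 := chain_m_gt0 WB.
have bW : bounded m N W := chain_white_bound WB.
exists 'I_m, 'I_N.+1, 'I_N.+1, (ord_set m N W), (ord_set m N B).
split; first exact: chain_spherical WB (N_gt0 k_gt0).
have [g g_bij gD] := canonical_group_iso bW m_gt0 lW tors.
pose D := {dffun forall i : 'I_k, 'Z_(n i)}.
(* At stage [k] the conditions on [h] cover all indices, so that it becomes an isomorphism onto the
   full product. *)
pose h' (c : C) : D := [ffun i => h c i].
have h'D : {morph h' : c d / (c + d)%R >-> (c * d)%g}.
  by move=> c d; apply/ffunP => i; rewrite !ffunE hD.
have h'_surj v : exists c, h' c = v.
  have [c cE] := h_surj v; exists c; apply/ffunP => i.
  by rewrite ffunE cE.
have h'_inj : injective h'.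
  move=> c d /ffunP cd; apply/eqP; rewrite -subr_eq0; apply/eqP/h_inj => i _.
  have := hD i (c - d)%R d; rewrite subrK; have := cd i; rewrite !ffunE => -> e.
  by apply: (addIr (h d i)); rewrite -e add0r.
have h'_bij : bijective h'.
  exists (fun v => sval (cid (h'_surj v))) => [c|v].
    by apply: h'_inj; case: cid.
  by case: cid.
exists (fun a => finv (h' (g a))).
  apply: bij_comp (bij_comp h'_bij g_bij); exact: (Bijective finvK fK).
by move=> a b; rewrite [g _]gD h'D; apply: (can_inj fK); rewrite fM !finvK.
Qed.
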